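(* Let $\mathcal{E}=\{([A_i,-A_i],A_i,1)\}_{i\in I}$ be a nonempty virtual extended multi-segment (in $(P')$ order, with first index $1$, so that $A_1=\max_i A_i$), with all $A_i\in\mathbb{Z}_{\ge0}$ and all signs $+1$. Let $m_{A_1}$ be the multiplicity of the column $A_1$ in $dual(\mathcal{E})$. Then $$|\Psi(\pi(\Theta_1(\mathcal{E})))|=\begin{cases}3 & \text{if } dual(\mathcal{E}) \text{ is a block starting at zero and } m_{A_1} \text{ is odd},\\ 2 & \text{otherwise.}\end{cases}$$
   Context: **Rows and multi-segments.** Fix an irreducible unitary self-dual supercuspidal representation $\rho$ of some $\mathrm{GL}_d(F)$ ($F$ a $p$-adic field) of orthogonal type; it is only a label and is suppressed. A row (extended segment) is $r=([A,B],l,\eta)$ with $A,B\in\mathbb{Z}$, $A+B\ge 0$, $b:=A-B+1\ge 1$, $l\in\mathbb{Z}$, $0\le l\le b/2$, $\eta\in\{\pm1\}$. Its support is $[A,B]$; put $a:=A+B+1$. A virtual extended multi-segment $\mathcal{E}$ is a finite family of rows $r_i=([A_i,B_i],l_i,\eta_i)$ indexed by a finite totally ordered set $(I,>)$ whose order is admissible: $A_i>A_j$ and $B_i>B_j$ imply $i>j$. The order satisfies $(P')$ if $B_i>B_j$ implies $i>j$. Families differing only in the signs $\eta_i$ of rows with $2l_i=b_i$ are identified. Unions are concatenations in the order written. **Row exchange $R_k$.** For adjacent $k<k+1$ such that interchanging them gives an admissible order, $R_k$ interchanges the two positions and changes only the data of these two rows. Put $C_i=b_i-2l_i$, $\epsilon=(-1)^{A_k-B_k}\eta_k\eta_{k+1}$.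 (1) If $[A_k,B_k]\supset[A_{k+1},B_{k+1}]$: $(l_{k+1}',\eta_{k+1}')=(l_{k+1},(-1)^{A_k-B_k}\eta_{k+1})$ and $(l_k',\eta_k')$ equals (a) $(b_k-l_k-C_{k+1},(-1)^{A_{k+1}-B_{k+1}}\eta_k)$ if $\epsilon=1$, $C_k<2C_{k+1}$; (b) $(l_k+C_{k+1},(-1)^{A_{k+1}-B_{k+1}+1}\eta_k)$ if $\epsilon=1$, $C_k\ge 2C_{k+1}$; (c) $(l_k-C_{k+1},(-1)^{A_{k+1}-B_{k+1}+1}\eta_k)$ if $\epsilon=-1$. (2) If $[A_k,B_k]\subset[A_{k+1},B_{k+1}]$: $(l_k',\eta_k')=(l_k,(-1)^{A_{k+1}-B_{k+1}}\eta_k)$ and $(l_{k+1}',\eta_{k+1}')$ equals (a) $(b_{k+1}-l_{k+1}-C_k,(-1)^{A_k-B_k}\eta_{k+1})$ if $\epsilon=1$, $C_{k+1}<2C_k$; (b) $(l_{k+1}+C_k,(-1)^{A_k-B_k+1}\eta_{k+1})$ if $\epsilon=1$, $C_{k+1}\ge 2C_k$; (c) $(l_{k+1}-C_k,(-1)^{A_k-B_k+1}\eta_{k+1})$ if $\epsilon=-1$. Any change of admissible order is a composition of row exchanges. **Union-intersection.** $ui_k$ applies to adjacent $k<k+1$ with $A_{k+1}>A_k$, $B_{k+1}>B_k$ if (same $\epsilon$) one of: Case 1: $\epsilon=1$, $A_{k+1}-l_{k+1}=A_k-l_k$; Case 2: $\epsilon=1$, $B_{k+1}+l_{k+1}=B_k+l_k$;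 Case 3: $\epsilon=-1$, $B_{k+1}+l_{k+1}=A_k-l_k+1$. It replaces the supports by $[A_{k+1},B_k]$ (position $k$) and $[A_k,B_{k+1}]$ (position $k+1$), and, with $\delta=A_{k+1}-A_k$, the data $(l_k,\eta_k,l_{k+1},\eta_{k+1})$ by: Case 1: $(l_k,\eta_k,l_{k+1}-\delta,(-1)^{\delta}\eta_{k+1})$; Case 2: $(l_k+\delta,\eta_k,l_{k+1},(-1)^\delta\eta_{k+1})$ if $C_k\ge\delta$, and $(b_k-l_k,-\eta_k,l_{k+1},(-1)^\delta\eta_{k+1})$ if $C_k<\delta$; Case 3: $(l_k,\eta_k,l_{k+1},(-1)^\delta\eta_{k+1})$ if $l_{k+1}\le l_k$, and $(l_k,\eta_k,l_k,(-1)^{\delta+1}\eta_{k+1})$ if $l_{k+1}>l_k$. In Case 3 with $l_k=l_{k+1}=0$ the row at position $k+1$ is deleted (type 3'). For $i,j$ with $A_i<A_j$, $B_i<B_j$ which become adjacent ($i$ immediately before $j$) in some admissible order, $ui_{i,j}$ means: change to that order by row exchanges, apply $ui$ if applicable, change back to the original order. **Dual.** If the order satisfies $(P')$, $dual(\mathcal{E})$ has rows $([A_i,-B_i],l_i+B_i,(-1)^{\alpha_i+\beta_i}\eta_i)$ in reversed order, where $\alpha_i=\sum_{j<i}a_j$, $\beta_i=\sum_{j>i}b_j$. **Equivalence and $\Psi$.** $\mathcal{E}\sim\mathcal{F}$ is the equivalence relation generated by the operators $R_k$, $ui_{i,j}$, and $dual\circ ui_{j,i}\circ dual$. Put $\psi_{\mathcal{F}}=\bigoplus_i\rho\otimes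 S_{a_i}\otimes S_{b_i}$ (equivalently, the multiset of supports of $\mathcal{F}$). Then $\Psi(\pi(\mathcal{E}))=\{\psi_{\mathcal{F}} : \mathcal{F}\sim\mathcal{E}\}$ (nonvanishing of the attached representation is preserved by these operators). **Blocks.** A tempered multi-segment has all rows of the form $([c,c],0,\eta)$, $c\ge0$, with the sign depending only on $c$, listed with $c$ increasing; for $\mathcal{E}$ as in the claim, $dual(\mathcal{E})$ is tempered with rows in the columns $A_i$. The multiplicity of the column $c$ is the number of rows with support $[c,c]$. A nonempty tempered multi-segment is a block starting at zero if its occurring columns are exactly $0,1,\dots,c_{\max}$ for some $c_{\max}$, each with odd multiplicity, with opposite signs in consecutive columns. **$\Theta_1$.** For $\mathcal{E}$ as in the claim, the extended multi-segment of the theta lift to the first occurrence in the going-up tower is $$\Theta_1(\mathcal{E})=\{([A_1+1,-A_1-1],\,A_1+1,\,-1)\}\cup\mathcal{E},$$ the new row being first. *)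

(* Defs.v *)
From HB Require Import structures.
From Stdlib Require Export Relation_Operators.
From mathcomp Require Export all_boot all_order all_algebra.
From mathcomp Require Export finmap multiset.
From mathcomp Require Export boolp classical_sets functions cardinality.

Set Implicit Arguments.
Unset Strict Implicit.
Unset Printing Implicit Defensive.

Import Order.TTheory GRing.Theory Num.Theory.
Local Open Scope mset_scope.
Local Open Scope ring_scope.

(* Extended segments ([A, B], l, eta).  The constraints on the four integers
   (in particular eta = 1 or -1) are collected in [valid_row]. *)

Record row := Row { rA : int; rB : int; rl : int; reta : int }.

Definition tuple_of_row (r : row) := (rA r, rB r, rl r, reta r).
Definition row_of_tuple (x : int * int * int * int) :=
  let: (A, B, l, eta) := x in Row A B l eta.
Lemma tuple_of_rowK : cancel tuple_of_row row_of_tuple.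
Proof. by case. Qed.
HB.instance Definition _ := Equality.copy row (can_type tuple_of_rowK).

Definition ra (r : row) : int := rA r + rB r + 1.
Definition rb (r : row) : int := rA r - rB r + 1.
Definition rC (r : row) : int := rb r - 2 * rl r.

Definition valid_row (r : row) : bool :=
  [&& 0 <= rA r + rB r, 1 <= rb r, 0 <= rl r, 2 * rl r <= rb r
    & (reta r == 1) || (reta r == -1)].

(* A family indexed by a finite totally ordered set is the list of its rows in
   increasing order, so the order is part of the family and conditions on the
   order are conditions on the list. *)

Definition admissible (E : seq row) : bool :=
  pairwise (fun r s => ~~ ((rA s < rA r) && (rB s < rB r))) E.

Definition vems (E : seq row) : bool := all valid_row E && admissible E.

Definition order_P' (E : seq row) : bool :=
  pairwise (fun r s => rB r <= rB s) E.

Definition sign_eq_row (r s : row) : bool :=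
  [&& rA r == rA s, rB r == rB s, rl r == rl s
    & (reta r == reta s) || (2 * rl r == rb r)].

Definition sign_eq (E F : seq row) : bool := all2 sign_eq_row E F.

Definition subsupp (r s : row) : bool := (rB s <= rB r) && (rA r <= rA s).

(* The sign epsilon of two adjacent rows, r immediately before s. *)
Definition eps (r s : row) : int := (-1) ^ (rA r - rB r) * reta r * reta s.

(* New data, under a row exchange, of the row i with the smaller support and
   of the row o with the larger one.  Cases (1) and (2) of the row exchange
   differ only by which of the two rows comes first, on which only the sign e
   depends. *)
Definition exch_inner (o i : row) : row :=
  Row (rA i) (rB i) (rl i) ((-1) ^ (rA o - rB o) * reta i).

Definition exch_outer (e : int) (o i : row) : row :=
  if e == 1 then
    if rC o < 2 * rC i then
      Row (rA o) (rB o) (rb o - rl o - rC i) ((-1) ^ (rA i - rB i) * reta o)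
    else
      Row (rA o) (rB o) (rl o + rC i) ((-1) ^ (rA i - rB i + 1) * reta o)
  else
    Row (rA o) (rB o) (rl o - rC i) ((-1) ^ (rA i - rB i + 1) * reta o).

(* [exchange r s t u]: the adjacent rows r, s become t, u, in this order, so
   that t carries the support of s and u that of r. *)
Inductive exchange (r s : row) : row -> row -> Prop :=
| Exchange1 of subsupp s r :
    exchange r s (exch_inner r s) (exch_outer (eps r s) r s)
| Exchange2 of subsupp r s :
    exchange r s (exch_outer (eps r s) s r) (exch_inner s r).

(* [ui r s t u]: the adjacent rows r, s become t, u; u is [None] when the
   second row is deleted (type 3'). *)
Definition ui_fst (r s : row) (l eta : int) : row := Row (rA s) (rB r) l eta.
Definition ui_snd (r s : row) (l eta : int) : row := Row (rA r) (rB s) l eta.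

Definition ui_case1 (r s : row) : row * option row :=
  let d := rA s - rA r in
  (ui_fst r s (rl r) (reta r),
   Some (ui_snd r s (rl s - d) ((-1) ^ d * reta s))).

Definition ui_case2 (r s : row) : row * option row :=
  let d := rA s - rA r in
  (if d <= rC r then ui_fst r s (rl r + d) (reta r)
   else ui_fst r s (rb r - rl r) (- reta r),
   Some (ui_snd r s (rl s) ((-1) ^ d * reta s))).

Definition ui_case3 (r s : row) : row * option row :=
  let d := rA s - rA r in
  (ui_fst r s (rl r) (reta r),
   if (rl r == 0) && (rl s == 0) then None
   else if rl s <= rl r then
     Some (ui_snd r s (rl s) ((-1) ^ d * reta s))
   else
     Some (ui_snd r s (rl r) ((-1) ^ (d + 1) * reta s))).

Inductive ui (r s : row) : row * option row -> Prop :=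
| Ui1 of rA r < rA s & rB r < rB s & eps r s = 1
      & rA s - rl s = rA r - rl r : ui r s (ui_case1 r s)
| Ui2 of rA r < rA s & rB r < rB s & eps r s = 1
      & rB s + rl s = rB r + rl r : ui r s (ui_case2 r s)
| Ui3 of rA r < rA s & rB r < rB s & eps r s = -1
      & rB s + rl s = rA r - rl r + 1 : ui r s (ui_case3 r s).

(* To express the return to the original order in ui_{i,j}, rows carry their
   index, which they keep while the order changes. *)

Definition lseg := seq (nat * row).

Definition label (E : seq row) : lseg := zip (iota 0 (size E)) E.
Definition rows (L : lseg) : seq row := unzip2 L.
Definition labels (L : lseg) : seq nat := unzip1 L.

(* The result of R_k has an admissible order by [vems (rows M)]. *)
Definition lexchange (L M : lseg) : Prop :=
  [/\ vems (rows L), vems (rows M) &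
  exists xs i r j s ys t u,
    [/\ L = xs ++ (i, r) :: (j, s) :: ys, exchange r s t u
      & M = xs ++ (j, t) :: (i, u) :: ys]].

Definition lsign_eq (L M : lseg) : Prop :=
  [/\ vems (rows L), vems (rows M), labels L = labels M
    & sign_eq (rows L) (rows M)].

Definition lui (L M : lseg) : Prop :=
  [/\ vems (rows L), vems (rows M) &
  exists xs i r j s ys t u,
    [/\ L = xs ++ (i, r) :: (j, s) :: ys, ui r s (t, u)
      & M = xs ++ (i, t) :: (if u is Some v then (j, v) :: ys else ys)]].

Definition reorder : lseg -> lseg -> Prop :=
  clos_refl_trans lseg (fun L M => lexchange L M \/ lsign_eq L M).

Definition step_R (E F : seq row) : Prop :=
  exists L M, [/\ rows L = E, rows M = F & lexchange L M].

(* F = ui_{i,j}(E) for some indices i, j; the labels of E are increasing, so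
   being back in the original order means that the labels increase. *)
Definition step_ui (E F : seq row) : Prop :=
  exists G G' H, [/\ reorder (label E) G, lui G G', reorder G' H,
                     sorted ltn (labels H) & rows H = F].

Definition dual_alpha (E : seq row) (i : nat) : int := \sum_(r <- take i E) ra r.
Definition dual_beta (E : seq row) (i : nat) : int := \sum_(r <- drop i.+1 E) rb r.

Definition dual_ems (E : seq row) : seq row :=
  rev (mkseq (fun i => let r := nth (Row 0 0 0 1) E i in
                Row (rA r) (- rB r) (rl r + rB r)
                    ((-1) ^ (dual_alpha E i + dual_beta E i) * reta r))
             (size E)).

Definition step_dual_ui_dual (E F : seq row) : Prop :=
  [/\ vems E, order_P' E, vems F &
  exists2 G, step_ui (dual_ems E) G & order_P' G /\ F = dual_ems G].

Definition step_sign (E F : seq row) : Prop :=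
  [/\ vems E, vems F & sign_eq E F].

Definition step (E F : seq row) : Prop :=
  [\/ step_sign E F, step_R E F, step_ui E F | step_dual_ui_dual E F].

Definition ems_equiv : seq row -> seq row -> Prop :=
  clos_refl_sym_trans (seq row) step.

(* psi = sum of the rho (x) S_a (x) S_b, as the multiset of the (a, b). *)
Definition psi (E : seq row) : {mset int * int} :=
  seq_mset [seq (ra r, rb r) | r <- E].

(* The set of local Arthur parameters of the representation attached to E. *)
Definition Psi (E : seq row) : set {mset int * int} :=
  [set m | exists2 F, ems_equiv F E & m = psi F]%classic.

Definition tempered (E : seq row) : bool :=
  [&& all (fun r => [&& rA r == rB r, 0 <= rA r, rl r == 0
                      & (reta r == 1) || (reta r == -1)]) E,
      pairwise (fun r s => rA r <= rA s) E
    & pairwise (fun r s => (rA r == rA s) ==> (reta r == reta s)) E].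

Definition multiplicity (c : int) (E : seq row) : nat :=
  count (fun r => (rA r == c) && (rB r == c)) E.

Definition block_at_zero (E : seq row) : Prop :=
  [/\ E != [::], tempered E,
      exists2 cmax : int, 0 <= cmax &
        forall c : int, (0 < multiplicity c E)%N = (0 <= c <= cmax),
      forall c : int, (0 < multiplicity c E)%N -> odd (multiplicity c E)
    & forall r s, r \in E -> s \in E -> rA s = rA r + 1 -> reta s = - reta r].

Definition first_A (E : seq row) : int := rA (head (Row 0 0 0 1) E).

Definition Theta1 (E : seq row) : seq row :=
  Row (first_A E + 1) (- first_A E - 1) (first_A E + 1) (-1) :: E.

(* Main.v *)
Require Import Defs.
From mathcomp Require Import zify.
Import Order.TTheory GRing.Theory Num.Theory.
Local Open Scope ring_scope.

(* Let N = A_1 and n = |I|.  Reorderings of Theta_1(E) form an explicit class S1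
   with supports [N+1, -N-1] and the [A_i, -A_i].  These supports are pairwise
   nested, so no ui applies to S1.  In its dual S1d the supports are [N+1, N+1]
   and the [A_i, A_i]; all signs agree except that of [N+1, N+1], so the only
   possible ui is the type 3' merging of [N, N] and [N+1, N+1] into [N+1, N],
   which leads to a class S2d without further ui.  Its dual S2 again has nested
   supports.  An inverse ui on S2 has to split [N+1, -N] into [N, -N] and
   [N+1, N+1], which forces N = 0 and n odd; then S2 = S2d, and S1d provides the
   third parameter.  As all signs in dual(E) agree, dual(E) is a block starting
   at zero with m_{A_1} odd exactly when N = 0 and n is odd. *)

Set Implicit Arguments.
Unset Strict Implicit.
Unset Printing Implicit Defensive.

(** * Integer powers of -1 *)

Lemma expN1z_even (z m : int) : z = m + m -> (-1 : int) ^ z = 1.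
Proof. by move=> ->; rewrite exprzDr // -exprMz_comm ?mulN1r ?opprK ?exp1rz //; exact: mulrC. Qed.

Lemma expN1z_odd (z m : int) : z = m + m + 1 -> (-1 : int) ^ z = -1.
Proof. by move=> ->; rewrite exprzDr // (@expN1z_even _ m) // mul1r expr1z. Qed.

Lemma expN1zD1 (z : int) : (-1 : int) ^ (z + 1) = - (-1) ^ z.
Proof. by rewrite exprzDr // expr1z mulrN1. Qed.

Lemma expN1z_inner (k : bool) (x : int) :
  (-1 : int) ^ (x - (if k then x else - x)) = 1.
Proof.
by case: k; [apply: (@expN1z_even _ 0) | apply: (@expN1z_even _ x)]; lia.
Qed.

Lemma expN1z_innerD1 (k : bool) (x : int) :
  (-1 : int) ^ (x - (if k then x else - x) + 1) = -1.
Proof. by rewrite expN1zD1 expN1z_inner. Qed.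

(** * Row exchanges among inner rows and one outer row *)

Definition is_sign (s : int) : bool := (s == 1) || (s == -1).

(* The rows ([A, -A], A, s) for k = false, and their duals ([A, A], 0, s) for
   k = true. *)
Definition inner (k : bool) (s : int) (r : row) : bool :=
  [&& rB r == (if k then rA r else - rA r), rl r == (if k then 0 else rA r)
    & reta r == s].

(** Used with X - Y = 2L, so that b = 2L + 1: C is 1 for p = false and 3 for p = true, against C = 1
    for every inner row. *)
Definition outer_odd (X Y L s : int) (p : bool) (o : row) : bool :=
  [&& rA o == X, rB o == Y, rl o == L - p%:Z
    & reta o == (if p then s else - s)].

(* For p = true, 2 l = b and the sign is free. *)
Definition outer_even (X Y L s : int) (p : bool) (o : row) : bool :=
  [&& rA o == X, rB o == Y, rl o == L + p%:Z
    & if p then is_sign (reta o) else reta o == s].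

Definition outer_spec := bool -> row -> bool.

(* [E] has a single row [o] that is not inner, and [e] lists the rA of the others.
   The data of [o] depend on the parity of the number of rows before it, since
   each exchange with an inner row toggles them. *)
Definition form (k : bool) (s1 s2 : int) (O : outer_spec) (e : seq int)
    (E : seq row) : Prop :=
  exists s o t, [/\ E = s ++ o :: t, all (inner k s1) s, all (inner k s2) t,
    O (odd (size s)) o & perm_eq [seq rA r | r <- s ++ t] e].

(** What [form] needs of an exchange between the outer row and an inner one: the inner row takes the
    sign of the side it moves to, and the parity flips. *)
Definition swaps (k : bool) (s1 s2 X : int) (O : outer_spec) : Prop :=
  forall p o i j u, O p o -> rA i < X ->
    (inner k s2 i -> exchange o i j u ->
       [/\ inner k s1 j, rA j = rA i & O (~~ p) u]) /\
    (inner k s1 i -> exchange i o u j ->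
       [/\ inner k s2 j, rA j = rA i & O (~~ p) u]).

Lemma row_eq r s : rA r = rA s -> rB r = rB s -> rl r = rl s -> reta r = reta s -> r = s.
Proof. by case: r s => [A B l h] [A' B' l' h'] /= -> -> -> ->. Qed.

Lemma exchangeP r s t u : exchange r s t u ->
  [/\ subsupp s r, t = exch_inner r s & u = exch_outer (eps r s) r s] \/
  [/\ subsupp r s, t = exch_outer (eps r s) s r & u = exch_inner s r].
Proof. by case; [left | right]. Qed.

(** Both rows have C = 1 and, as their signs agree and A - B is even, epsilon = 1. Case (a) then
    gives b - l - 1 = l and even powers of -1. *)
Lemma exchange_inner k s r r' t u : is_sign s ->
  inner k s r -> inner k s r' -> exchange r r' t u -> t = r' /\ u = r.
Proof.
case: r r' => [A B l h] [A' B' l' h'] hs /and3P[/= /eqP-> /eqP-> /eqP->].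
case/and3P=> /= /eqP-> /eqP-> /eqP->.
have ss : s * s = 1 by case/orP: hs => /eqP->.
case=> _; split; rewrite /exch_inner /exch_outer /eps /rC /rb /= ?expN1z_inner ?mul1r ?ss ?eqxx //.
  by case: k; (case: ifP; last lia) => _; congr Row; lia.
by case: k; (case: ifP; last lia) => _; congr Row; lia.
Qed.

(** At C = 1 epsilon is -1 and case (c) lowers l by one; at C = 3 epsilon is 1 and case (b) restores
    it. *)
Lemma swaps_odd k X Y L s c : is_sign s -> X - Y = L + L ->
  swaps k s s X (fun p => outer_odd X Y L s (c (+) p)).
Proof.
move=> hs XY p [A B l h] [A' B' l' h'] j u.
rewrite addbN; move: (c (+) p) => {}p.
have eXY : (-1 : int) ^ (X - Y) = 1 by apply: (@expN1z_even _ L).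
case/and4P=> /= /eqP-> /eqP-> /eqP-> /eqP-> AX.
have ss : s * s = 1 by case/orP: hs => /eqP->.
split=> /and3P[/= /eqP-> /eqP-> /eqP->] /exchangeP[][hsub -> ->]; move: hsub;
  rewrite /inner /outer_odd /subsupp /exch_inner /exch_outer /eps /rC /rb /=
    ?expN1z_inner ?expN1z_innerD1 ?eXY ?mul1r ?mulN1r ?mulrN ?mulNr;
  case/andP=> B1 B2; case: k B1 B2 => B1 B2; try lia; case: p; case/orP: hs => /eqP->; rewrite /=.
all: by do ?[case: ifP]; move=> *; split=> //=; lia.
Qed.

(** The outer row has A - B odd, so an inner row changes sign when passing it. At C = 2 case (b)
    raises l by one; at C = 0 cases (a) and (c), one for each choice of the free sign, both lead
    back. *)
Lemma swaps_even k X Y L s c : is_sign s -> X - Y = L + L + 1 ->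
  swaps k s (- s) X (fun p => outer_even X Y L s (c (+) p)).
Proof.
move=> hs XY p [A B l h] [A' B' l' h'] j u.
rewrite addbN; move: (c (+) p) => {}p.
have eXY : (-1 : int) ^ (X - Y) = -1 by apply: (@expN1z_odd _ L).
case/and4P=> /= /eqP-> /eqP-> /eqP-> H AX.
split=> /and3P[/= /eqP-> /eqP-> /eqP->] /exchangeP[][hsub -> ->]; move: hsub;
  rewrite /inner /outer_even /is_sign /subsupp /exch_inner /exch_outer /eps /rC
    /rb /= ?expN1z_inner ?expN1z_innerD1 ?eXY ?mul1r ?mulN1r ?mulrN ?mulNr;
  case/andP=> B1 B2; case: k B1 B2 => B1 B2; try lia; move: H; case: p => /=;
  try case/orP; move/eqP->; case/orP: hs => /eqP->; rewrite /=.
all: by do ?[case: ifP]; move=> *; split=> //=; lia.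
Qed.

Lemma cat_cons_eq (T : Type) (xs ys s t : seq T) (r o : T) :
  xs ++ r :: ys = s ++ o :: t ->
  [\/ (exists2 z, s = xs ++ r :: z & ys = z ++ o :: t),
      [/\ xs = s, r = o & ys = t]
    | exists2 z, t = z ++ r :: ys & xs = s ++ o :: z].
Proof.
elim: xs s => [|x xs IH] [|y s] /= [].
- by move=> -> ->; apply: Or32.
- by move=> -> ->; apply: Or31; exists s.
- by move=> -> <-; apply: Or33; exists xs.
move=> -> /IH[[z -> ->]|[-> -> ->]|[z -> ->]].
- by apply: Or31; exists z.
- exact: Or32.
- by apply: Or33; exists z.
Qed.

Lemma form_exchange k s1 s2 X O e xs r r' ys t u :
  is_sign s1 -> is_sign s2 -> swaps k s1 s2 X O -> all (< X) e ->
  exchange r r' t u ->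
  form k s1 s2 O e (xs ++ r :: r' :: ys) -> form k s1 s2 O e (xs ++ t :: u :: ys).
Proof.
move=> hs1 hs2 sw eX ex [s [o [s' [E hs hs' hO hp]]]].
have Xlt i : i \in s ++ s' -> rA i < X.
  by move=> ii; apply: (allP eX); rewrite -(perm_mem hp) map_f.
(* Position of the pair: [r] before [o] (with [r'] = [o] when [z] is empty), [r] = [o], or both rows
   after [o]. *)
case: (cat_cons_eq E) => {E} [[z Es E]|[Exs Er E]|[z Es' E]].
- case: z => [|i z] in Es E *.
    case: E => ? ?; subst s o s'.
    have rX : rA r < X by apply: Xlt; rewrite !mem_cat mem_head orbT.
    move: hs hO hp; rewrite all_cat size_cat /= addn1 /= => /and3P[hxs hr _] hO hp.
    have [_ /(_ hr ex)[hu Au Ot]] := sw _ _ _ u t hO rX.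
    exists xs, t, (u :: ys); rewrite /= hxs hu hs' negbK in Ot *; split=> //.
    by move: hp; rewrite -catA /= !map_cat /= Au.
  case: E => Er' E; subst i s ys.
  have [hr hr'] : inner k s1 r /\ inner k s1 r'.
    by move: hs; rewrite all_cat /= => /and4P[].
  have [-> ->] := exchange_inner hs1 hr hr' ex.
  exists (xs ++ r' :: r :: z), o, s'; split=> //.
  - by rewrite -catA.
  - by move: hs; rewrite !all_cat /= => /and4P[-> -> -> ->].
  - by move: hO; rewrite !size_cat.
  apply: perm_trans hp; apply: perm_map; rewrite -!catA perm_cat2l.
  exact: (permEl (perm_catCA [:: r'] [:: r] _)).
- subst xs r s'.
  have rX : rA r' < X by apply: Xlt; rewrite mem_cat mem_head orbT.
  move: hs' => /= /andP[hr' hys].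
  have [/(_ hr' ex)[ht At Ou] _] := sw _ _ _ t u hO rX.
  exists (s ++ [:: t]), u, ys; split=> //.
  - by rewrite -catA.
  - by rewrite all_cat hs /= ht.
  - by rewrite size_cat addn1.
  by move: hp; rewrite -catA !map_cat /= At.
subst xs s'.
have [hr hr'] : inner k s2 r /\ inner k s2 r'.
  by move: hs'; rewrite all_cat /= => /and4P[].
have [-> ->] := exchange_inner hs2 hr hr' ex.
exists s, o, (z ++ r' :: r :: ys); split=> //.
- by rewrite -catA.
- by move: hs'; rewrite !all_cat /= => /and4P[-> -> -> ->].
apply: perm_trans hp; apply: perm_map; rewrite !perm_cat2l.
exact: (permEl (perm_catCA [:: r'] [:: r] _)).
Qed.

(** A sign is free only where 2l = b. Inner rows and rows in [outer_odd] have b odd; a row in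
    [outer_even] has 2l = b exactly for p = true, where the sign is left open. *)
Definition sign_stable (O : outer_spec) : Prop :=
  forall p o o', O p o -> sign_eq_row o o' -> valid_row o' -> O p o'.

Lemma sign_stable_odd X Y L s c : X - Y = L + L ->
  sign_stable (fun p => outer_odd X Y L s (c (+) p)).
Proof.
move=> XY p [A B l h] [A' B' l' h'] /and4P[/= /eqP-> /eqP-> /eqP-> /eqP->].
rewrite /sign_eq_row /outer_odd /rb /= => /and4P[/eqP<- /eqP<- /eqP<-] H _.
by rewrite !eqxx /= eq_sym; case/orP: H => [//|]; lia.
Qed.

Lemma sign_stable_even X Y L s c : X - Y = L + L + 1 ->
  sign_stable (fun p => outer_even X Y L s (c (+) p)).
Proof.
move=> XY p [A B l h] [A' B' l' h'] /and4P[/= /eqP-> /eqP-> /eqP-> H].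
rewrite /sign_eq_row /valid_row /outer_even /rb /=.
case/and4P=> /eqP<- /eqP<- /eqP<- H2 /and5P[_ _ _ _ hv]; rewrite !eqxx /=.
by case: (c (+) p) H H2 => //=; lia.
Qed.

Lemma all_inner_sign_eq k s E F : all (inner k s) E -> sign_eq E F -> E = F.
Proof.
elim: E F => [|r E IH] [|r' F] //= /andP[hr hE] /andP[H /(IH _ hE)->].
congr cons; case: r r' hr H => [A B l h] [A' B' l' h'] /and3P[/= /eqP-> /eqP-> /eqP->].
rewrite /sign_eq_row /rb /= => /and4P[/eqP<- /eqP<- /eqP<- H].
by move: H; case: (k) => H; congr Row; lia.
Qed.

Lemma sign_eq_split s o t F : sign_eq (s ++ o :: t) F ->
  exists s' o' t', [/\ F = s' ++ o' :: t', sign_eq s s', sign_eq_row o o' & sign_eq t t'].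
Proof.
elim: s F => [|r s IH] [|r' F] //= /andP[H1 H2]; first by exists [::], r', F.
have [s' [o' [t' [-> ss oo tt]]]] := IH _ H2.
by exists (r' :: s'), o', t'; rewrite /= H1.
Qed.

Lemma form_sign_eq k s1 s2 O e E F : sign_stable O -> all valid_row F ->
  sign_eq E F -> form k s1 s2 O e E -> form k s1 s2 O e F.
Proof.
move=> st vF EF [s [o [t [E_ hs ht hO hp]]]]; subst E.
have [s' [o' [t' [F_ ss oo tt]]]] := sign_eq_split EF.
move: vF; rewrite F_ all_cat /= => /and3P[_ vo _].
rewrite -(all_inner_sign_eq hs ss) -(all_inner_sign_eq ht tt).
by exists s, o', t; split=> //; apply: st oo vo.
Qed.

Lemma sign_eq_rowC r s : sign_eq_row r s = sign_eq_row s r.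
Proof.
rewrite /sign_eq_row /rb; apply/idP/idP => /and4P[/eqP-> /eqP-> /eqP->];
  by rewrite !eqxx /= eq_sym.
Qed.

Lemma sign_eqC E F : sign_eq E F = sign_eq F E.
Proof. by elim: E F => [|r E IH] [|s F] //=; rewrite sign_eq_rowC IH. Qed.

Lemma sign_eq_refl E : sign_eq E E.
Proof. by elim: E => //= r E ->; rewrite /sign_eq_row !eqxx. Qed.

Lemma sign_eq_cat E1 E2 F1 F2 : sign_eq E1 F1 -> sign_eq E2 F2 ->
  sign_eq (E1 ++ E2) (F1 ++ F2).
Proof.
by elim: E1 F1 => [|r E IH] [|s F] //= /andP[-> EF] /(IH _ EF)->.
Qed.

(** * Inverting a row exchange *)

Lemma is_sign_exp (z : int) : is_sign ((-1) ^ z).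
Proof.
have [->|->] : z = (z %/ 2)%Z + (z %/ 2)%Z \/ z = (z %/ 2)%Z + (z %/ 2)%Z + 1 by lia.
  by rewrite (@expN1z_even _ (z %/ 2)%Z).
by rewrite (@expN1z_odd _ (z %/ 2)%Z).
Qed.

Lemma exch_outer_cases e o i :
  [\/ [/\ e = 1, rC o < 2 * rC i & exch_outer e o i =
        Row (rA o) (rB o) (rb o - rl o - rC i) ((-1) ^ (rA i - rB i) * reta o)],
      [/\ e = 1, 2 * rC i <= rC o & exch_outer e o i =
        Row (rA o) (rB o) (rl o + rC i) (- (-1) ^ (rA i - rB i) * reta o)]
    | e <> 1 /\ exch_outer e o i =
        Row (rA o) (rB o) (rl o - rC i) (- (-1) ^ (rA i - rB i) * reta o)].
Proof.
rewrite /exch_outer expN1zD1; case: eqP => [->|e1]; last exact: Or33.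
by case: ltP => H; [apply: Or31 | apply: Or32].
Qed.

(** Cases (b) and (c) invert each other, and (a) inverts itself as it replaces C by 2C_i - C. If C =
    0, it is (b) that inverts (a), and the sign returns only up to the identification at 2l = b. *)
Lemma exch_outerK (e e' : int) o i : is_sign e -> valid_row o -> valid_row i ->
  e' = e * (-1) ^ (rA i - rB i) * reta o * reta (exch_outer e o i) ->
  sign_eq_row (exch_outer e' (exch_outer e o i) (exch_inner o i)) o.
Proof.
case: o i => [A B l h] [A' B' l' h'] he; rewrite /valid_row /rb /=.
case/and5P=> _ _ v0 v1 v2 /and5P[_ _ _ v3 v4].
have := exch_outer_cases e (Row A B l h) (Row A' B' l' h').
rewrite /rC /rb /=; have := is_sign_exp (A' - B').
move: (expN1zD1 (A' - B')); set x := (-1) ^ (A' - B') => ex1 hx.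
have ex0 : (-1) ^ (A' - B') = x by []; clearbody x.
case=> [[-> C ->]|[-> C ->]|[He ->]] /=.
- have -> : 1 * x * h * (x * h) = 1 by case/orP: hx v2 => /eqP-> /orP[] /eqP->.
  move=> ->; rewrite /sign_eq_row /exch_outer /rC /rb /= ex1.
  by rewrite ex0; case: ifP => /= ?; case/orP: hx v2 => /eqP-> /orP[] /eqP->; lia.
- have -> : 1 * x * h * (- x * h) = -1 by case/orP: hx v2 => /eqP-> /orP[] /eqP->.
  move=> ->; rewrite /sign_eq_row /exch_outer /rC /rb /= ex1.
  by rewrite ?ex0; case/orP: hx v2 => /eqP-> /orP[] /eqP->; lia.
have -> : e = -1 by case/orP: he => /eqP.
have -> : -1 * x * h * (- x * h) = 1 by case/orP: hx v2 => /eqP-> /orP[] /eqP->.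
move=> ->; rewrite /sign_eq_row /exch_outer /rC /rb /= ex1.
by rewrite ex0; case: ifP => /= ?; case/orP: hx v2 => /eqP-> /orP[] /eqP->; lia.
Qed.

Lemma exch_outer_supp e o i :
  rA (exch_outer e o i) = rA o /\ rB (exch_outer e o i) = rB o.
Proof. by rewrite /exch_outer; case: ifP => // _; case: ifP. Qed.

Lemma exch_innerK o o' i : rA o' = rA o -> rB o' = rB o ->
  exch_inner o' (exch_inner o i) = i.
Proof.
case: i => [A B l h] /= eA eB; rewrite /exch_inner /= eA eB mulrA.
by case/orP: (is_sign_exp (rA o - rB o)) => /eqP->; rewrite ?mulN1r ?opprK mul1r.
Qed.

Lemma is_signM (x y : int) : is_sign x -> is_sign y -> is_sign (x * y).
Proof. by case/orP=> /eqP-> /orP[] /eqP->. Qed.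

Lemma exchange_sym r s t u : valid_row r -> valid_row s -> exchange r s t u ->
  exists r' s', [/\ exchange t u r' s', sign_eq_row r' r & sign_eq_row s' s].
Proof.
move=> vr vs ex; have sr : is_sign (eps r s).
  case/and5P: vr vs => _ _ _ _ hr /and5P[_ _ _ _ hs].
  by rewrite /eps !is_signM ?is_sign_exp.
case/exchangeP: ex => -[sub -> ->].
  have [eA eB] := exch_outer_supp (eps r s) r s.
  exists (exch_outer (eps (exch_inner r s) (exch_outer (eps r s) r s))
    (exch_outer (eps r s) r s) (exch_inner r s)), s; split.
  - rewrite -[X in exchange _ _ _ X](exch_innerK s eA eB); apply: Exchange2.
    by rewrite /subsupp eA eB.
  - apply: exch_outerK => //; rewrite /eps /=; set x := reta (exch_outer _ _ _).
    move: vr vs => /and5P[_ _ _ _ hr] /and5P[_ _ _ _ hs].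
    case/orP: (is_sign_exp (rA s - rB s)) => /eqP->;
    case/orP: (is_sign_exp (rA r - rB r)) => /eqP->; case/orP: hr => /eqP->; case/orP: hs => /eqP->; lia.
  - by rewrite /sign_eq_row !eqxx.
have [eA eB] := exch_outer_supp (eps r s) s r.
exists r, (exch_outer (eps (exch_outer (eps r s) s r) (exch_inner s r))
    (exch_outer (eps r s) s r) (exch_inner s r)); split.
- rewrite -[X in exchange _ _ X](exch_innerK r eA eB); apply: Exchange1.
  by rewrite /subsupp eA eB.
- by rewrite /sign_eq_row !eqxx.
- apply: exch_outerK => //; rewrite /eps /= eA eB; set x := reta (exch_outer _ _ _).
  move: vr vs => /and5P[_ _ _ _ hr] /and5P[_ _ _ _ hs].
  case/orP: (is_sign_exp (rA s - rB s)) => /eqP->;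
  case/orP: (is_sign_exp (rA r - rB r)) => /eqP->; case/orP: hr => /eqP->; case/orP: hs => /eqP->; lia.
Qed.

(** * Invariance under reordering *)

Lemma form_lexchange_sym k s1 s2 X O e L M : is_sign s1 -> is_sign s2 ->
  swaps k s1 s2 X O -> all (< X) e -> sign_stable O ->
  lexchange L M -> form k s1 s2 O e (rows M) -> form k s1 s2 O e (rows L).
Proof.
move=> hs1 hs2 sw eX st [/andP[vL _] _ [xs [i [r [j [r' [ys [t [u [EL ex ->]]]]]]]]]].
move: vL; rewrite {}EL /rows /unzip2 !map_cat /= => vL.
have [vr vr'] : valid_row r /\ valid_row r'.
  by move: vL; rewrite all_cat /= => /and4P[].
have [r1 [r1' [ex' e1 e2]]] := exchange_sym vr vr' ex.
move/(form_exchange hs1 hs2 sw eX ex'); apply: form_sign_eq => //.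
by apply: sign_eq_cat (sign_eq_refl _) _; rewrite /= e1 e2 sign_eq_refl.
Qed.

(** An equivalence is required because [ems_equiv] is a symmetric closure: steps may also be taken
    backwards. *)
Definition order_invariant (K : seq row -> Prop) : Prop :=
  forall L M, lexchange L M \/ lsign_eq L M -> (K (rows L) <-> K (rows M)).

Lemma order_invariant_form k s1 s2 X O e : is_sign s1 -> is_sign s2 ->
  swaps k s1 s2 X O -> all (< X) e -> sign_stable O ->
  order_invariant (form k s1 s2 O e).
Proof.
move=> hs1 hs2 sw eX st L M [ex|[/andP[vL _] /andP[vM _] _ LM]]; split.
- case: ex => _ _ [xs [i [r [j [r' [ys [t [u [-> ex ->]]]]]]]]].
  by rewrite /rows /unzip2 !map_cat /=; apply: form_exchange sw eX ex.
- exact: form_lexchange_sym sw eX st ex.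
- exact: form_sign_eq.
- by apply: form_sign_eq => //; rewrite sign_eqC.
Qed.

Lemma order_invariant_or K1 K2 : order_invariant K1 -> order_invariant K2 ->
  order_invariant (fun E => K1 E \/ K2 E).
Proof. by move=> H1 H2 L M LM; rewrite (H1 _ _ LM) (H2 _ _ LM). Qed.

Lemma reorder_invariant K L M : order_invariant K -> reorder L M ->
  (K (rows L) <-> K (rows M)).
Proof.
move=> HK; elim=> {L M} [L M LM|L|L M P _ -> _ ->] //; exact: HK.
Qed.

Lemma rows_label E : rows (label E) = E.
Proof. by rewrite /rows /label unzip2_zip // size_iota. Qed.

Definition ui_invariant (K : seq row -> Prop) : Prop :=
  forall L M, lui L M -> (K (rows L) <-> K (rows M)).

Lemma step_ui_invariant K E F : order_invariant K -> ui_invariant K ->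
  step_ui E F -> (K E <-> K F).
Proof.
move=> HK HU [G [G' [H [EG /HU GG' G'H _ <-]]]].
by rewrite -(reorder_invariant HK G'H) -GG' -(reorder_invariant HK EG) rows_label.
Qed.

(** * The dual *)

Lemma expN1z_eq (x y m : int) : x = y + (m + m) -> (-1 : int) ^ x = (-1) ^ y.
Proof. by move=> ->; rewrite exprzDr // (@expN1z_even (m + m) m) // mulr1. Qed.

Definition dual_row (T : int) (r : row) : row :=
  Row (rA r) (- rB r) (rl r + rB r) ((-1) ^ (T + ra r) * reta r).

Definition sum_ra (E : seq row) : int := \sum_(r <- E) ra r.

Lemma sum_rb E : \sum_(r <- E) rb r = sum_ra E - (\sum_(r <- E) rB r) - \sum_(r <- E) rB r.
Proof.
rewrite /sum_ra -!sumrB; apply: eq_bigr => r _; rewrite /ra /rb; lia.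
Qed.

(* a_i and b_i have the same parity, so alpha_i + beta_i only depends on i
   through a_i. *)
Lemma dual_emsE E : dual_ems E = rev (map (dual_row (sum_ra E)) E).
Proof.
congr rev; apply: (@eq_from_nth _ (Row 0 0 0 1)) => [|i].
  by rewrite size_mkseq size_map.
rewrite size_mkseq => iE; rewrite nth_mkseq // (nth_map (Row 0 0 0 1)) //.
congr Row; congr (_ * _).
rewrite /dual_alpha /dual_beta sum_rb.
have -> : sum_ra E = \sum_(r <- take i E) ra r + (ra (nth (Row 0 0 0 1) E i) + sum_ra (drop i.+1 E)).
  by rewrite /sum_ra -{1}(cat_take_drop i E) big_cat (drop_nth (Row 0 0 0 1) iE) big_cons.
set B := \sum_(r <- _) rB r; set a := ra _.
apply: (@expN1z_eq _ _ (- B - a)); rewrite /sum_ra; lia.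
Qed.

(** The total of the a_i in the dual is the total of the b_i, which has the same parity as before,
    and a + b = 2A + 2 for each row; so the two sign factors cancel. *)
Lemma dual_emsK E : dual_ems (dual_ems E) = E.
Proof.
rewrite !dual_emsE map_rev revK -map_comp -[RHS]map_id; apply: eq_map => r /=.
have -> : sum_ra (rev (map (dual_row (sum_ra E)) E)) =
    sum_ra E - (\sum_(r <- E) rB r) - \sum_(r <- E) rB r.
  rewrite -sum_rb /sum_ra big_rev /= big_map; apply: eq_bigr => ? _.
  by rewrite /ra /rb /=; lia.
set B := \sum_(r <- _) _; case: r => [A b l h]; rewrite /dual_row /ra /=.
congr Row; [lia | lia | rewrite mulrA -exprzDr // (@expN1z_even _ (sum_ra E - B + A + 1)) ?mul1r //].
lia.
Qed.

Lemma pairwise_rev (T : Type) (r : rel T) s :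
  pairwise r (rev s) = pairwise (fun x y => r y x) s.
Proof.
elim: s => //= x s IH.
by rewrite rev_cons -cats1 pairwise_cat /= allrel1r all_rev IH andbT.
Qed.

Lemma order_P'_dual E : order_P' (dual_ems E) = order_P' E.
Proof.
rewrite /order_P' dual_emsE pairwise_rev pairwise_map.
by apply: eq_pairwise => r s /=; rewrite lerN2.
Qed.

Lemma inner_dual k s T r : inner k s r ->
  inner (~~ k) (- (-1) ^ T * s) (dual_row T r).
Proof.
case: r => [A B l h] /and3P[/= /eqP-> /eqP-> /eqP->].
rewrite /inner /dual_row /ra /= -expN1zD1.
rewrite (@expN1z_eq (T + (A + _ + 1)) (T + 1) (if k then A else 0)) ?eqxx; last by case: k => /=; lia.
by case: k; rewrite ?addr0 ?opprK ?add0r ?subrr !eqxx.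
Qed.

(** Each inner row has a odd: 1 for [A, -A] and 2A + 1 for [A, A]. *)
Lemma sum_ra_inner k s1 s2 s o t : all (inner k s1) s -> all (inner k s2) t ->
  (-1 : int) ^ sum_ra (s ++ o :: t) = (-1) ^ ((size (s ++ t))%:Z + ra o).
Proof.
move=> hs ht; have inn h u : all (inner k h) u ->
    exists m, sum_ra u = (size u)%:Z + (m + m).
  rewrite /sum_ra; elim: u => [|r u IH] /=; first by exists 0; rewrite big_nil.
  case/andP=> /and3P[/eqP hB _ _] /IH[m Em].
  exists (m + if k then rA r else 0); rewrite big_cons Em /ra hB; case: k {IH hs ht} hB => /=; lia.
have [m1 E1] := inn _ _ hs; have [m2 E2] := inn _ _ ht.
apply: (@expN1z_eq _ _ (m1 + m2)); move: E1 E2; rewrite /sum_ra big_cat big_cons size_cat /= => -> ->.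
lia.
Qed.

(** Reversal swaps the two sides of the outer row, so s1 and s2 trade roles and the parity shifts by
    that of [size e]. The sign x comes from the total of the a_i; inner rows get -x because their
    own a is odd. *)
Lemma form_dual k s1 s2 s1' s2' (O O' : outer_spec) e E :
  (forall p o, O p o -> let x := (-1) ^ ((size e)%:Z + ra o) in
     [/\ - x * s2 = s1', - x * s1 = s2' &
       O' (odd (size e) (+) p)
         (Row (rA o) (- rB o) (rl o + rB o) (x * (-1) ^ ra o * reta o))]) ->
  form k s1 s2 O e E -> form (~~ k) s1' s2' O' e (dual_ems E).
Proof.
move=> HO [s [o [t [-> hs ht hO hp]]]].
have [] := HO _ _ hO; have se := perm_size hp; rewrite size_map in se.
rewrite -se -(sum_ra_inner o hs ht) dual_emsE; set T := sum_ra _ => h2 h1 hO'.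
have inn h h' u : - (-1) ^ T * h = h' -> all (inner k h) u ->
    all (inner (~~ k) h') (rev (map (dual_row T) u)).
  by move=> <- /allP hu; rewrite all_rev all_map; apply/allP => r /hu; apply: inner_dual.
exists (rev (map (dual_row T) t)), (dual_row T o), (rev (map (dual_row T) s)); split.
- by rewrite map_cat rev_cat /= rev_cons cat_rcons.
- exact: inn ht.
- exact: inn hs.
- move: hO'; rewrite size_cat oddD -addbA addbC -addbA addbb addbF size_rev size_map.
  by rewrite /dual_row exprzDr.
apply: perm_trans hp; rewrite -rev_cat -map_cat map_rev perm_rev -map_comp.
exact: perm_refl.
Qed.

Lemma form_dual_odd k s X Y L c e E : X - Y = L + L ->
  form k s s (fun p => outer_odd X Y L s (c (+) p)) e E ->
  let s' := (-1) ^ (size e)%:Z * s in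
  form (~~ k) s' s'
    (fun p => outer_odd X (- Y) (L + Y) s' ((c (+) odd (size e)) (+) p)) e (dual_ems E).
Proof.
move=> XY; apply: form_dual => p o /and4P[/eqP oX /eqP oY /eqP oL /eqP oh].
have Ea : (-1) ^ ra o = -1 :> int by rewrite /ra oX oY; apply: (@expN1z_odd _ (Y + L)); lia.
rewrite exprzDr // Ea oX oY oL oh /= !mulrN1 !opprK; split=> //.
rewrite /outer_odd /= -addbA addKb !eqxx /=.
case: (_ (+) _); rewrite /= ?mulrN !eqxx andbT; lia.
Qed.

Lemma form_dual_even k s X Y L c e E : is_sign s -> X - Y = L + L + 1 ->
  form k s (- s) (fun p => outer_even X Y L s (c (+) p)) e E ->
  let s' := (-1) ^ (size e)%:Z * s in
  form (~~ k) s' (- s')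
    (fun p => outer_even X (- Y) (L + Y) s' ((c (+) odd (size e)) (+) p)) e (dual_ems E).
Proof.
move=> hs XY; apply: form_dual => p o /and4P[/eqP oX /eqP oY /eqP oL oh].
have Ea : (-1) ^ ra o = 1 :> int by rewrite /ra oX oY; apply: (@expN1z_even _ (Y + L + 1)); lia.
rewrite exprzDr // Ea oX oY oL /= !mulr1; split; rewrite ?mulNr ?mulrN ?opprK //.
rewrite /outer_even /= -addbA addKb !eqxx /=.
case: (_ (+) _) oh => /= [oh|/eqP->]; rewrite ?eqxx ?is_signM ?is_sign_exp ?andbT //; lia.
Qed.

(** * Union-intersection: supports and positions *)

Definition opt_seq (u : option row) : seq row := if u is Some v then [:: v] else [::].

Lemma lui_rows L M : lui L M -> exists xs r s ys t u,
  [/\ rows L = xs ++ r :: s :: ys, rows M = xs ++ t :: opt_seq u ++ ys,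
      ui r s (t, u), vems (rows L) & vems (rows M)].
Proof.
case=> vL vM [xs [i [r [j [s [ys [t [u [EL h EM]]]]]]]]].
exists (unzip2 xs), r, s, (unzip2 ys), t, u; split=> //.
  by rewrite EL /rows /unzip2 map_cat.
by rewrite EM /rows /unzip2 map_cat /=; case: (u).
Qed.

Lemma ui_supp r s t u : ui r s (t, u) ->
  [/\ rA r < rA s, rB r < rB s, rA t = rA s, rB t = rB r &
    if u is Some v then rA v = rA r /\ rB v = rB s
    else [/\ rl r = 0, rl s = 0, rB s = rA r + 1, eps r s = -1 &
             t = Row (rA s) (rB r) 0 (reta r)]].
Proof.
move Ex: (t, u) => x h; case: h Ex => hA hB he hl; rewrite /ui_case1 /ui_case2 /ui_case3.
- by case=> -> ->.
- by case=> -> ->; case: ifP.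
case=> -> ->; split=> //; case: ifP => [/andP[/eqP l1 /eqP l2]|_]; last by case: ifP.
by split=> //; rewrite ?l1 //; move: hl; rewrite l1 l2; lia.
Qed.

Lemma form_mem k s1 s2 O e E r : form k s1 s2 O e E -> r \in E ->
  (rA r \in e) && (inner k s1 r || inner k s2 r) \/ exists p, O p r.
Proof.
case=> [s [o [t [-> hs ht hO hp]]]]; rewrite mem_cat in_cons.
have in_e x : x \in s ++ t -> rA x \in e.
  by move=> xs; rewrite -(perm_mem hp); apply: map_f.
case/or3P=> [rs|/eqP->|rt]; last 2 first.
- by right; exists (odd (size s)).
- by left; rewrite in_e ?mem_cat ?rt ?orbT //= (allP ht) ?orbT.
by left; rewrite in_e ?mem_cat ?rs //= (allP hs).
Qed.

Lemma mem_pair (xs ys : seq row) r s : r \in xs ++ r :: s :: ys /\ s \in xs ++ r :: s :: ys.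
Proof. by rewrite !mem_cat !in_cons !eqxx !orbT. Qed.

Lemma vems_valid E r : vems E -> r \in E -> valid_row r.
Proof. by case/andP=> /allP h _ /h. Qed.

Lemma admissible_tail xs r ys : admissible (xs ++ r :: ys) ->
  {in ys, forall y, rA y < rA r -> rB y < rB r -> False}.
Proof.
rewrite /admissible pairwise_cat /= => /and4P[_ _ /allP h _] y /h + hA hB.
by rewrite hA hB.
Qed.

(** An inner row has A and B at most N, so after [x] it would violate admissibility. *)
Lemma inner_tail_nil (N : int) k h xs x ys : admissible (xs ++ x :: ys) ->
  N < rA x -> N < rB x -> all (inner k h) ys ->
  (forall y, y \in ys -> 0 <= rA y <= N) -> ys = [::].
Proof.
case: ys => // y ys /admissible_tail/(_ y (mem_head _ _)) hy hA hB.
move=> /andP[/and3P[/eqP By _ _] _] /(_ y (mem_head _ _)) yN.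
by case: hy; rewrite ?By; case: k {By} => /=; lia.
Qed.

(** The outer row is recognised by its A exceeding N. *)
Lemma form_outer_unique (N : int) k s1 s2 O f xs t ys :
  (forall A, A \in f -> A <= N) -> N < rA t ->
  form k s1 s2 O f (xs ++ t :: ys) ->
  [/\ all (inner k s1) xs, all (inner k s2) ys, O (odd (size xs)) t
    & perm_eq [seq rA r | r <- xs ++ ys] f].
Proof.
move=> hf ht [s' [o [t' [E' hs' ht' hO hp]]]].
have in_f x : x \in s' ++ t' -> rA x <= N.
  by move=> xs'; apply: hf; rewrite -(perm_mem hp) map_f.
case: (cat_cons_eq E') => [[z Es _]|[-> -> ->] //|[z Es _]].
- by have := in_f t; rewrite Es !mem_cat mem_head orbT => /(_ isT); lia.
- by have := in_f t; rewrite Es !mem_cat mem_head !orbT => /(_ isT); lia.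
Qed.

(** Equal signs give epsilon = 1, which rules out Case 3. As l = 0, Cases 1 and 2 would force equal
    A or equal B. *)
Lemma ui_inner_dual h r s x : is_sign h -> inner true h r -> inner true h s -> ~ ui r s x.
Proof.
move=> hh /and3P[/eqP Br /eqP lr /eqP er] /and3P[/eqP Bs /eqP ls /eqP es].
have ep : eps r s = 1.
  by rewrite /eps Br subrr er es mul1r; case/orP: hh => /eqP->.
by case=> hA hB; rewrite ep // lr ls; lia.
Qed.

(** * The classes of Theta_1(E) and of its dual *)

Section Classes.
Variables (N : int) (e : seq int).
Hypotheses (N_ge0 : 0 <= N) (e_N : all (fun A => 0 <= A <= N) e).

(** [N :: e] lists all the A_i, so this is (-1)^n, the sign that dualising gives to the inner rows
    of [S1]. *)
Definition tau : int := (-1) ^ (size (N :: e))%:Z.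

Definition S1 := form false 1 1
  (fun p => outer_odd (N + 1) (- (N + 1)) (N + 1) 1 (false (+) p)) (N :: e).
Definition S2 := form false (-1) (- -1)
  (fun p => outer_even (N + 1) (- N) N (-1) (false (+) p)) e.
(** Adding the parity of the number of all inner rows turns the parity of the rows before the outer
    row into that of the rows after it, as the dual reverses the order. *)
Definition S1d := form true tau tau
  (fun p => outer_odd (N + 1) (N + 1) 0 tau (odd (size (N :: e)) (+) p)) (N :: e).
Definition S2d := form true tau (- tau)
  (fun p => outer_even (N + 1) N 0 tau (odd (size e) (+) p)) e.

Lemma tau_sign : is_sign tau. Proof. exact: is_sign_exp. Qed.

Lemma e_bound A : A \in N :: e -> 0 <= A <= N.
Proof. by rewrite in_cons => /orP[/eqP->|/(allP e_N)//]; rewrite N_ge0 lexx. Qed.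

Lemma S1_supp E r : S1 E -> r \in E -> 0 <= rA r <= N + 1 /\ rB r = - rA r.
Proof.
move=> h /(form_mem h)[/andP[/e_bound hA /orP[] /and3P[/eqP hB _ _]]|[p]].
- by split=> //; lia.
- by split=> //; lia.
by case/and4P=> /eqP-> /eqP-> _ _; split=> //; lia.
Qed.

Lemma S2_supp E r : S2 E -> r \in E -> 0 <= rA r <= N /\ rB r = - rA r \/
  rA r = N + 1 /\ rB r = - N /\ N <= rl r.
Proof.
move=> h /(form_mem h)[/andP[hA]|[p]].
  have {}hA : 0 <= rA r <= N by apply: e_bound; rewrite in_cons hA orbT.
  by case/orP=> /and3P[/eqP hB _ _]; left.
by case/and4P=> /eqP-> /eqP-> /eqP-> _; right; split=> //; lia.
Qed.

Lemma S1d_supp E r : S1d E -> r \in E -> 0 <= rA r <= N + 1 /\ rB r = rA r.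
Proof.
move=> h /(form_mem h)[/andP[/e_bound hA /orP[] /and3P[/eqP hB _ _]]|[p]].
- by split=> //; lia.
- by split=> //; lia.
by case/and4P=> /eqP-> /eqP-> _ _; split=> //; lia.
Qed.

Lemma S2d_supp E r : S2d E -> r \in E -> 0 <= rA r <= N /\ rB r = rA r \/
  rA r = N + 1 /\ rB r = N.
Proof.
move=> h /(form_mem h)[/andP[hA]|[p]].
  have {}hA : 0 <= rA r <= N by apply: e_bound; rewrite in_cons hA orbT.
  by case/orP=> /and3P[/eqP hB _ _]; left.
by case/and4P=> /eqP-> /eqP-> _ _; right.
Qed.

Lemma S1_ui_fwd L M : lui L M -> ~ S1 (rows L).
Proof.
move=> /lui_rows[xs [r [s [ys [t [u [EL EM h vL vM]]]]]]] H.
have [hr hs] := mem_pair xs ys r s; rewrite -EL in hr hs.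
have [_ r2] := S1_supp H hr; have [_ s2] := S1_supp H hs.
by case: (ui_supp h) => hA hB _ _ _; lia.
Qed.

Lemma S2_ui_fwd L M : lui L M -> ~ S2 (rows L).
Proof.
move=> /lui_rows[xs [r [s [ys [t [u [EL EM h vL vM]]]]]]] H.
have [hr hs] := mem_pair xs ys r s; rewrite -EL in hr hs.
have r2 := S2_supp H hr; have s2 := S2_supp H hs.
by case: (ui_supp h) => hA hB _ _ _; lia.
Qed.

(** The row t = [A_s, B_r] would have B_r = -A_s, and then A_r < A_s contradicts A_r + B_r >= 0. *)
Lemma S1_ui_bwd L M : lui L M -> ~ S1 (rows M).
Proof.
move=> /lui_rows[xs [r [s [ys [t [u [EL EM h vL vM]]]]]]] H.
have [hr hs] := mem_pair xs ys r s; rewrite -EL in hr hs.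
have /and5P[vr _ _ _ _] := vems_valid vL hr.
have /S1_supp-/(_ H)[t1 t2] : t \in rows M by rewrite EM mem_cat in_cons eqxx orbT.
case: (ui_supp h) => hA hB tA tB; case: (u) EM => [v|] EM.
  have /S1_supp-/(_ H)[v1 v2] : v \in rows M by rewrite EM mem_cat !in_cons eqxx !orbT.
  by case; lia.
by case; lia.
Qed.

(** The row t = [A_s, B_r] would have B_r = A_s, so A_s < B_s. *)
Lemma S1d_ui_bwd L M : lui L M -> ~ S1d (rows M).
Proof.
move=> /lui_rows[xs [r [s [ys [t [u [EL EM h vL vM]]]]]]] H.
have [hr hs] := mem_pair xs ys r s; rewrite -EL in hr hs.
have /and5P[_ vs _ _ _] := vems_valid vL hs.
have /S1d_supp-/(_ H)[t1 t2] : t \in rows M by rewrite EM mem_cat in_cons eqxx orbT.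
by case: (ui_supp h) vs; rewrite /rb => hA hB tA tB _; lia.
Qed.

Lemma S2_ui_bwd L M : lui L M -> S2 (rows M) -> N = 0 /\ odd (size (N :: e)).
Proof.
move=> /lui_rows[xs [r [s [ys [t [u [EL EM h vL vM]]]]]]] H.
have [hr hs] := mem_pair xs ys r s; rewrite -EL in hr hs.
have /and5P[vr _ _ _ _] := vems_valid vL hr.
have /S2_supp-/(_ H) t1 : t \in rows M by rewrite EM mem_cat in_cons eqxx orbT.
(* The row [t] cannot be inner, so it is [N+1, -N] and A_r = N. A second row [v] would be [N, B_s]
   with B_s > -N, which does not occur in [S2]. *)
case: (ui_supp h) => hA hB tA tB; case: (u) EM => [v|] EM.
  have /S2_supp-/(_ H) v1 : v \in rows M by rewrite EM mem_cat !in_cons eqxx !orbT.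
  by case; lia.
case=> lr ls Bs es Et.
(* Type 3' leaves l = 0 on [t], while the outer row of [S2] has l at least N. *)
have [tN N0] : rA t = N + 1 /\ N = 0 by move: t1; rewrite Et /=; lia.
split=> //; rewrite EM /= in H.
have e_le A : A \in e -> 0 <= A <= N by move=> Ae; apply: e_bound; rewrite in_cons Ae orbT.
have [||hxs hys hO hp] := form_outer_unique (N := N) _ _ H; [by move=> A /e_le/andP[]|lia|].
have ys_nil : ys = [::].
  have /andP[_ aL] := vL; rewrite EL -cat_rcons in aL.
  apply: @inner_tail_nil N _ _ _ _ _ aL _ _ hys _ => [||y hy]; [lia..|].
  by apply: e_le; rewrite -(perm_mem hp) map_f // mem_cat hy orbT.
subst ys; rewrite cats0 in hp; move: (perm_size hp); rewrite size_map /= => <-.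
(* With l = 0 the parity must be even; all inner rows lie before [t], so [e] has even length. *)
case/and4P: hO => _ _ /eqP; rewrite Et addFb /= N0.
by case: (odd (size xs)) => //=; lia.
Qed.

Lemma S1d_ui_fwd L M : lui L M -> S1d (rows L) -> S2d (rows M).
Proof.
move=> /lui_rows[xs [r [s [ys [t [u [EL EM h vL vM]]]]]]] H.
have [hr hs] := mem_pair xs ys r s; rewrite -EL in hr hs.
have [hA hB tA tB hu] := ui_supp h.
have inn x : x \in rows L -> rA x <= N -> inner true tau x.
  move=> xL xN; case: (form_mem H xL) => [/andP[_ /orP[]//]|[p]].
  by case/and4P=> /eqP oA; lia.
have [s1 s2] := S1d_supp H hs; have [r1 r2] := S1d_supp H hr.
have r_in : inner true tau r by apply: inn => //; lia.
have [sN|sN] : rA s <= N \/ rA s = N + 1 by lia.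
  by case: (ui_inner_dual tau_sign r_in (inn _ hs sN) h).
move: H; rewrite EL -cat_rcons => H.
have /andP[_ aL] := vL; rewrite EL -cat_rcons in aL.
have [||hxs hys hO hp] := form_outer_unique (N := N) _ _ H; [by move=> A /e_bound/andP[]|lia|].
have ys_nil : ys = [::].
  apply: @inner_tail_nil N _ _ _ _ _ aL _ _ hys _ => [||y hy]; [lia..|].
  by apply: e_bound; rewrite -(perm_mem hp) map_f // mem_cat hy orbT.
subst ys; rewrite cats0 in hp.
have sz := perm_size hp; rewrite size_map size_rcons in sz.
(* The outer row is last, so the parity cancels the shift, leaving l = 0 and sign -tau. *)
case/and4P: hO => _ _; rewrite size_rcons -sz addbb subr0 => /eqP ls /eqP es.
case/and3P: (r_in) => _ /eqP lr /eqP er.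
have ep : eps r s = -1.
  by rewrite /eps r2 subrr er es mul1r mulrN; case/orP: tau_sign => /eqP->.
(* Only Case 3 has epsilon = -1, and its condition N + 1 = A_r + 1 gives A_r = N. *)
have [rN Et Eu] : [/\ rA r = N, t = Row (N + 1) N 0 tau & u = None].
  move Ex: (t, u) h => x hx; case: hx Ex; rewrite ?ep // ls lr s2 => _ _ _ Br.
  have rN : rA r = N by lia.
  by rewrite /ui_case3 lr ls eqxx /= /ui_fst er r2 rN sN => -[-> ->].
exists xs, t, [::]; rewrite EM Eu /=; split=> //.
- by move: hxs; rewrite all_rcons => /andP[].
- by rewrite /outer_even Et /= !eqxx -[size e](eq_add_S _ _ sz) addbb.
by move: hp; rewrite cats0 map_rcons perm_rcons rN perm_cons.
Qed.

(** Adjacent inner rows fall under [ui_inner_dual]. For an inner row just before [N+1, N], the bound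
    B_r < N leaves only Case 3 with A_r = N - 1 and l = 0, but there epsilon = 1. *)
Lemma S2d_ui_fwd L M : lui L M -> ~ S2d (rows L).
Proof.
move=> /lui_rows[xs [r [s [ys [t [u [EL EM h vL vM]]]]]]] H.
have [hr hs] := mem_pair xs ys r s; rewrite -EL in hr hs.
have [hA hB tA tB hu] := ui_supp h.
have s1 := S2d_supp H hs; have r1 := S2d_supp H hr.
case: H => [s' [o [t' [E' hs' ht' hO hp]]]]; rewrite EL in E'.
have tau'_sign : is_sign (- tau) by case/orP: tau_sign => /eqP->.
have in_e x : x \in s' ++ t' -> 0 <= rA x <= N.
  by move=> xs'; apply: e_bound; rewrite in_cons -(perm_mem hp) map_f ?orbT.
case/and4P: hO => /eqP oA /eqP oB /eqP ol oe.
case: (cat_cons_eq E') => [[[|s0 z] Es [] ? Et]|[_ ro st]|[z Et' _]].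
- subst s t' s'; move: hs'; rewrite all_cat /= => /and3P[_ /and3P[/eqP Br /eqP lr /eqP er] _].
  case: (h) => _ _ ee; rewrite ?oA ?oB lr ol; move: oe ol; case: (_ (+) _) => /=; try by lia.
  move=> /eqP oe _; suff : eps r o = 1 by lia.
  by rewrite /eps Br subrr er oe mul1r; case/orP: tau_sign => /eqP->.
- subst s0 s' ys; move: hs'; rewrite all_cat /= => /and4P[_ hr' hs' _].
  exact: ui_inner_dual tau_sign hr' hs' h.
- have /in_e : s \in s' ++ t' by rewrite -st mem_cat mem_head orbT.
  by move: hA; rewrite ro oA; lia.
move: ht'; rewrite Et' all_cat /= => /and4P[_ hr' hs'' _].
exact: ui_inner_dual tau'_sign hr' hs'' h.
Qed.

(** The new row [t] can only be [N+1, N], which gives r = [N, N]; a second row [N, B_s] with B_s > N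
    does not occur in [S2d], so the type is 3' and s = [N+1, N+1]. Its sign follows from epsilon =
    -1. *)
Lemma S2d_ui_bwd L M : lui L M -> S2d (rows M) -> S1d (rows L).
Proof.
move=> /lui_rows[xs [r [s [ys [t [u [EL EM h vL vM]]]]]]] H.
have [hr hs] := mem_pair xs ys r s; rewrite -EL in hr hs.
have /and5P[_ vs _ _ _] := vems_valid vL hs.
have /and5P[_ vr _ _ _] := vems_valid vL hr.
have /S2d_supp-/(_ H) t1 : t \in rows M by rewrite EM mem_cat in_cons eqxx orbT.
case: (ui_supp h) vs vr; rewrite /rb => hA hB tA tB.
case: u EM h => [v|] EM h.
  have /S2d_supp-/(_ H) v1 : v \in rows M by rewrite EM mem_cat !in_cons eqxx !orbT.
  by case; lia.
case=> lr ls Bs es Et vs vr.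
have [As Br Ar] : [/\ rA s = N + 1, rB r = N & rA r = N] by split; lia.
rewrite EM /= in H.
have e_le A : A \in e -> 0 <= A <= N by move=> Ae; apply: e_bound; rewrite in_cons Ae orbT.
have [||hxs hys hO hp] := form_outer_unique (N := N) _ _ H; [by move=> A /e_le/andP[]|lia|].
have ys_nil : ys = [::].
  have /andP[_ aL] := vL; rewrite EL -cat_rcons in aL.
  apply: @inner_tail_nil N _ _ _ _ _ aL _ _ hys _ => [||y hy]; [lia..|].
  by apply: e_le; rewrite -(perm_mem hp) map_f // mem_cat hy orbT.
subst ys; rewrite cats0 in hp.
have sz := perm_size hp; rewrite size_map in sz.
case/and4P: hO => _ _ _; rewrite sz addbb /= Et /= => /eqP er.
rewrite EL -cat_rcons; exists (rcons xs r), s, [::]; split=> //.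
- by rewrite all_rcons hxs /inner Br Ar lr er !eqxx.
- rewrite /outer_odd As Bs Ar ls size_rcons sz /= addbb !eqxx /=.
  move: es; rewrite /eps Br Ar subrr er mul1r.
  by case/orP: tau_sign => /eqP->; lia.
by rewrite cats0 map_rcons perm_rcons Ar perm_cons.
Qed.
End Classes.

(** * Duality between the classes *)

Lemma tauE (N : int) e : (-1) ^ (size e)%:Z = - tau N e.
Proof. by rewrite /tau /= -addn1 PoszD expN1zD1 opprK. Qed.

Lemma tau_sqr (N : int) e : tau N e * tau N e = 1.
Proof. by case/orP: (tau_sign N e) => /eqP->. Qed.

Lemma S1_dual (N : int) e E : S1 N e E -> S1d N e (dual_ems E).
Proof.
move/(@form_dual_odd _ _ _ _ (N + 1)) => /(_ ltac:(lia)) /=.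
by rewrite mulr1 opprK subrr.
Qed.

Lemma S1d_dual (N : int) e E : S1d N e E -> S1 N e (dual_ems E).
Proof.
move/(@form_dual_odd _ _ _ _ 0) => /(_ ltac:(lia)) /=.
by rewrite -/(tau N e) tau_sqr add0r addbb.
Qed.

Lemma S2_dual (N : int) e E : S2 N e E -> S2d N e (dual_ems E).
Proof.
move/(@form_dual_even _ _ _ _ N) => /(_ isT ltac:(lia)) /=.
by rewrite (tauE N) mulrN1 !opprK subrr.
Qed.

Lemma S2d_dual (N : int) e E : S2d N e E -> S2 N e (dual_ems E).
Proof.
move/(@form_dual_even _ _ _ _ 0) => /(_ (tau_sign N e) ltac:(lia)) /=.
by rewrite (tauE N) mulNr tau_sqr add0r addbb.
Qed.

(** * Stability under every generating step *)

Section EquivalenceClass.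
Variables (N : int) (e : seq int).
Hypotheses (N_ge0 : 0 <= N) (e_N : all (fun A => 0 <= A <= N) e).

Let e_lt : all (< (N + 1)) e.
Proof. by apply/allP => A /(allP e_N) /=; lia. Qed.

Let Ne_lt : all (< (N + 1)) (N :: e).
Proof. by rewrite /= e_lt andbT; lia. Qed.

Lemma order_invariant_S1 : order_invariant (S1 N e).
Proof.
apply: (@order_invariant_form _ _ _ (N + 1)) => //.
  by apply: (@swaps_odd _ _ _ _ _ false) => //; lia.
by apply: (@sign_stable_odd _ _ _ _ false); lia.
Qed.

Lemma order_invariant_S2 : order_invariant (S2 N e).
Proof.
apply: (@order_invariant_form _ _ _ (N + 1)) => //.
  by apply: (@swaps_even _ _ _ _ _ false) => //; lia.
by apply: (@sign_stable_even _ _ _ _ false); lia.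
Qed.

Lemma order_invariant_S1d : order_invariant (S1d N e).
Proof.
have ts := tau_sign N e.
apply: (@order_invariant_form _ _ _ (N + 1)) => //.
  by apply: swaps_odd => //; lia.
by apply: sign_stable_odd; lia.
Qed.

Lemma is_signN s : is_sign s -> is_sign (- s).
Proof. by case/orP=> /eqP->. Qed.

Lemma order_invariant_S2d : order_invariant (S2d N e).
Proof.
have ts := tau_sign N e.
apply: (@order_invariant_form _ _ _ (N + 1)) => //.
- exact: is_signN.
- by apply: swaps_even => //; lia.
by apply: sign_stable_even; lia.
Qed.

(** The case with three parameters; [block_special] identifies it with the condition of the
    theorem. *)
Definition special : bool := (N == 0) && odd (size (N :: e)).

(** For N = 0 each inner row is ([0, 0], 0, s), its own kind of dual; n odd makes tau = -1 and the
    parity shift zero, so both descriptions coincide. *)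
Lemma S2_special E : special -> S2 N e E <-> S2d N e E.
Proof.
case/andP=> /eqP N0 on.
have t1 : (tau N e) = -1 by rewrite /tau -exprnP -signr_odd on.
have oe : odd (size e) = false by apply: negbTE; move: on.
have inn h (s t : seq row) : perm_eq [seq rA r | r <- s ++ t] e ->
    (all (inner false h) s = all (inner true h) s) /\
    (all (inner false h) t = all (inner true h) t).
  move=> hp; have H r : r \in s ++ t -> inner false h r = inner true h r.
    move=> rs; have : rA r \in e by rewrite -(perm_mem hp) map_f.
    by move/(allP e_N) => /= rN; rewrite /inner (_ : rA r = 0) ?oppr0 //; lia.
  by split; apply: eq_in_all => r rs; apply: H; rewrite mem_cat rs ?orbT.
by split=> -[s [o [t [-> hs ht hO hp]]]]; exists s, o, t; split=> //;
  move: hs ht hO; rewrite t1 ?oe ?N0 ?(inn _ _ _ hp).1 ?(inn _ _ _ hp).2.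
Qed.

(** [S1] and [S2] are linked through their duals; in the special case a direct ui links [S1d] to
    [S2]. The dual counterpart below is where the ui of a dual-ui-dual step takes place. *)
Definition theta_class E := S1 N e E \/ S2 N e E \/ special /\ S1d N e E.
Definition theta_dual_class E := S1d N e E \/ S2d N e E \/ special /\ S1 N e E.

Lemma order_invariant_and (b : bool) H : order_invariant H ->
  order_invariant (fun E => b /\ H E).
Proof. by move=> HH L M LM; rewrite (HH _ _ LM). Qed.

Lemma order_invariant_class : order_invariant theta_class.
Proof.
apply: order_invariant_or order_invariant_S1 _.
apply: order_invariant_or order_invariant_S2 _.
exact: order_invariant_and order_invariant_S1d.
Qed.

Lemma order_invariant_dual_class : order_invariant theta_dual_class.
Proof.
apply: order_invariant_or order_invariant_S1d _.
apply: order_invariant_or order_invariant_S2d _.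
exact: order_invariant_and order_invariant_S1.
Qed.

Lemma ui_invariant_class : ui_invariant theta_class.
Proof.
move=> L M LM; split=> -[H|[H|[sp H]]].
- by case: (S1_ui_fwd N_ge0 e_N LM H).
- by case: (S2_ui_fwd N_ge0 e_N LM H).
- by right; left; apply/S2_special => //; apply: S1d_ui_fwd LM H.
- by case: (S1_ui_bwd N_ge0 e_N LM H).
- have sp : special by have [N0 on] := S2_ui_bwd N_ge0 e_N LM H; rewrite /special on N0.
  by right; right; split=> //; apply: S2d_ui_bwd LM _ => //; apply/S2_special.
- by case: (S1d_ui_bwd N_ge0 e_N LM H).
Qed.

Lemma ui_invariant_dual_class : ui_invariant theta_dual_class.
Proof.
move=> L M LM; split=> -[H|[H|[sp H]]].
- by right; left; apply: S1d_ui_fwd LM H.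
- by case: (S2d_ui_fwd N_ge0 e_N LM H).
- by case: (S1_ui_fwd N_ge0 e_N LM H).
- by case: (S1d_ui_bwd N_ge0 e_N LM H).
- by left; apply: S2d_ui_bwd LM H.
- by case: (S1_ui_bwd N_ge0 e_N LM H).
Qed.

Lemma theta_class_dual E : theta_class E <-> theta_dual_class (dual_ems E).
Proof.
split=> -[H|[H|[sp H]]].
- by left; apply: S1_dual.
- by right; left; apply: S2_dual.
- by right; right; split=> //; apply: S1d_dual.
- by left; rewrite -[E]dual_emsK; apply: S1d_dual.
- by right; left; rewrite -[E]dual_emsK; apply: S2d_dual.
- by right; right; split=> //; rewrite -[E]dual_emsK; apply: S1_dual.
Qed.

Lemma step_invariant E F : step E F -> (theta_class E <-> theta_class F).
Proof.
case=> [[vE vF EF]|[L [M [<- <- LM]]]|EF|[_ _ _ [G EG [_ ->]]]].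
- have sz : size E = size F by apply/eqP; move: EF; rewrite /sign_eq all2E => /andP[].
  have := order_invariant_class (L := label E) (M := label F).
  rewrite !rows_label; apply; right; split; rewrite ?rows_label //.
  by rewrite /labels /label !unzip1_zip ?size_iota // sz.
- by apply: order_invariant_class; left.
- exact: step_ui_invariant order_invariant_class ui_invariant_class EF.
rewrite theta_class_dual (step_ui_invariant order_invariant_dual_class ui_invariant_dual_class EG).
by rewrite theta_class_dual dual_emsK.
Qed.

Lemma ems_equiv_invariant E F : ems_equiv E F -> (theta_class E <-> theta_class F).
Proof.
elim=> {E F} [E F /step_invariant //|//|E F _ -> //|E F G _ -> _ -> //].
Qed.

End EquivalenceClass.

(** * Parameters read off from a form *)

Definition inner_par (k : bool) (A : int) : int * int :=
  if k then (A + A + 1, 1) else (1, A + A + 1).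

Lemma psi_form k s1 s2 (O : outer_spec) e E ab :
  (forall p o, O p o -> (ra o, rb o) = ab) ->
  form k s1 s2 O e E -> psi E = seq_mset (ab :: map (inner_par k) e).
Proof.
move=> HO [s [o [t [-> hs ht hO hp]]]]; apply/eq_seq_msetP.
have inn h u : all (inner k h) u ->
    [seq (ra r, rb r) | r <- u] = map (inner_par k) (map rA u).
  move/allP=> hu; rewrite -map_comp; apply/eq_in_map => r /hu /and3P[/eqP hB _ _].
  by rewrite /inner_par /ra /rb /= hB; case: k {hu hs ht hB HO} => /=; congr pair; lia.
rewrite map_cat /= (inn _ _ hs) (inn _ _ ht) (HO _ _ hO) -cat_rcons -cats1 -catA.
rewrite perm_catCA /= perm_cons -map_cat; apply: perm_map.
by rewrite -map_cat.
Qed.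

(** * Equivalent multi-segments realising the parameters *)

Lemma order_P'_admissible E : order_P' E -> admissible E.
Proof. by apply: sub_pairwise => r s rs; rewrite negb_and -!leNgt rs orbT. Qed.

Lemma lui_last xs r s t : vems (xs ++ [:: r; s]) -> vems (xs ++ [:: t]) ->
  ui r s (t, None) -> exists M, [/\ lui (label (xs ++ [:: r; s])) M,
    rows M = xs ++ [:: t] & labels M = iota 0 (size xs).+1].
Proof.
move=> vD vG h.
exists (zip (iota 0 (size xs)) xs ++ [:: (size xs, t)]); split.
- split; first by rewrite rows_label.
    by rewrite /rows /unzip2 map_cat -/unzip2 unzip2_zip // size_iota.
  exists (zip (iota 0 (size xs)) xs), (size xs), r, (size xs).+1, s, [::], t, None.
  by rewrite /label size_cat iotaD zip_cat ?size_iota.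
- by rewrite /rows /unzip2 map_cat -/unzip2 unzip2_zip // size_iota.
by rewrite /labels /unzip1 map_cat -/unzip1 unzip1_zip ?size_iota // -addn1 iotaD.
Qed.

(** The remaining labels still increase, so both reorderings may be trivial. *)
Lemma step_ui_last E M n : lui (label E) M -> labels M = iota 0 n -> step_ui E (rows M).
Proof.
move=> LM lM; exists (label E), M, M; split=> //; try exact: rt_refl.
by rewrite lM iota_ltn_sorted.
Qed.

Section Members.
Variables (N : int) (e : seq int).
Hypotheses (N_ge0 : 0 <= N) (e_N : all (fun A => 0 <= A <= N) e).

Lemma S2_vems E : S2 N e E -> vems E.
Proof.
move=> H; apply/andP; split; last first.
  apply/(pairwiseP (Row 0 0 0 1)) => i j; rewrite !inE => iE jE _.
  move: (S2_supp N_ge0 e_N H (mem_nth (Row 0 0 0 1) iE)).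
  move: (S2_supp N_ge0 e_N H (mem_nth (Row 0 0 0 1) jE)).
  by move: (nth _ E i) (nth _ E j) => r s hs hr /=; lia.
apply/allP => r /(form_mem H)[/andP[/(allP e_N) hA]|[p]].
  by case/orP=> /and3P[/eqP hB /eqP hl /eqP he]; rewrite /valid_row /rb hB hl he; lia.
rewrite /valid_row /rb => /and4P[/eqP-> /eqP-> /eqP->]; rewrite /is_sign.
by case: (_ (+) p) => /= H1; lia.
Qed.

Lemma S1_valid E : S1 N e E -> all valid_row E.
Proof.
move=> H; apply/allP => r /(form_mem H)[/andP[/(e_bound N_ge0 e_N) hA]|[p]].
  by case/orP=> /and3P[/eqP hB /eqP hl /eqP he]; rewrite /valid_row /rb hB hl he; lia.
rewrite /valid_row /rb => /and4P[/eqP-> /eqP-> /eqP->].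
by case: (_ (+) p) => /= H1; lia.
Qed.

(** The outer row is last by [inner_tail_nil]. In (P') order B = A increases along the inner rows,
    so the maximal column N comes just before it and the pair to merge is adjacent. *)
Lemma S1d_last D : S1d N e D -> order_P' D ->
  exists2 xs, D = xs ++ [:: Row N N 0 (tau N e); Row (N + 1) (N + 1) 0 (- tau N e)]
    & all (inner true (tau N e)) xs.
Proof.
move=> [s [o [t [ED hs ht hO hp]]]] PD.
have in_e r : r \in s ++ t -> 0 <= rA r <= N.
  by move=> rs; apply: (e_bound N_ge0 e_N); rewrite -(perm_mem hp) map_f.
case/and4P: hO => /eqP oA /eqP oB ol oe.
have t_nil : t = [::].
  have aD : admissible (s ++ o :: t) by rewrite -ED order_P'_admissible.
  apply: @inner_tail_nil N _ _ _ _ _ aD _ _ ht _ => [||r rt]; [lia..|].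
  by apply: in_e; rewrite mem_cat rt orbT.
rewrite {}t_nil cats0 in ED in_e hp {ht}.
have sz : size s = size (N :: e) by rewrite -(perm_size hp) size_map.
case/lastP: s ED hs hp in_e sz ol oe => [|xs r] ED hs hp in_e sz ol oe; first by [].
move: hs; rewrite all_rcons => /andP[hr hxs].
have rN : rA r = N.
  have /mapP[y] : N \in [seq rA r | r <- rcons xs r] by rewrite (perm_mem hp) mem_head.
  have rle := in_e r; rewrite mem_rcons mem_head in rle; have {}rle := rle isT.
  rewrite mem_rcons in_cons => /orP[/eqP->//|yxs] Ey.
  move: PD; rewrite ED cat_rcons /order_P' pairwise_cat /=.
  move=> /and3P[/allrelP/(_ y r yxs (mem_head _ _)) + _ _].
  have /and3P[/eqP-> _ _] := allP hxs _ yxs; case/and3P: hr => /eqP-> _ _; lia.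
exists xs => //; rewrite ED cat_rcons; congr (_ ++ [:: _; _]).
  by case/and3P: hr => /eqP hB /eqP hl /eqP he; apply: row_eq; rewrite ?hB.
by move: ol oe; rewrite sz addbb => /eqP ol /eqP oe; apply: row_eq; rewrite ?ol.
Qed.

Lemma ui_type3' h : is_sign h ->
  ui (Row N N 0 h) (Row (N + 1) (N + 1) 0 (- h)) (Row (N + 1) N 0 h, None).
Proof.
move=> hh; apply: (@Ui3 (Row N N 0 h) (Row (N + 1) (N + 1) 0 (- h))) => /=; try lia.
by rewrite /eps /= subrr mul1r mulrN; case/orP: hh => /eqP->.
Qed.

Lemma inner_valid k h r : is_sign h -> 0 <= rA r -> inner k h r -> valid_row r.
Proof.
rewrite /is_sign /valid_row /rb => hh hA /and3P[/eqP-> /eqP-> /eqP->].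
by case: k; lia.
Qed.

Lemma lui_S1d_last xs : all (inner true (tau N e)) xs ->
  {in xs, forall r, 0 <= rA r <= N} ->
  let r := Row N N 0 (tau N e) in let s := Row (N + 1) (N + 1) 0 (- tau N e) in
  let t := Row (N + 1) N 0 (tau N e) in
  order_P' (xs ++ [:: r; s]) ->
  [/\ order_P' (xs ++ [:: t]), step_ui (xs ++ [:: r; s]) (xs ++ [:: t])
    & S1d N e (xs ++ [:: r; s]) <-> S2d N e (xs ++ [:: t])].
Proof.
move=> hxs xsN r s t PD; have ts := tau_sign N e.
have PG : order_P' (xs ++ [:: t]).
  move: PD; rewrite /order_P' !pairwise_cat !allrel_consr !allrel0r /= !andbT.
  by case/and3P=> /andP[-> _] -> _.
have vxs : all valid_row xs.
  apply/allP => x xin; apply: (inner_valid ts _ (allP hxs _ xin)).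
  by case/andP: (xsN _ xin).
have vD : vems (xs ++ [:: r; s]).
  rewrite /vems order_P'_admissible // all_cat vxs /= /valid_row /rb /=.
  by move: ts; rewrite /is_sign; lia.
have vG : vems (xs ++ [:: t]).
  rewrite /vems order_P'_admissible // all_cat vxs /= /valid_row /rb /=.
  by move: ts; rewrite /is_sign; lia.
have [M [LM EM lM]] := lui_last vD vG (ui_type3' ts).
split=> //; rewrite -EM; first exact: step_ui_last LM lM.
rewrite -[xs ++ [:: r; s]]rows_label; split; first exact: S1d_ui_fwd LM.
exact: S2d_ui_bwd LM.
Qed.

(** A single dual-ui-dual step, whose ui merges the last two rows of the dual. *)
Lemma equiv_S2 E : S1 N e E -> order_P' E -> exists2 F, S2 N e F & ems_equiv E F.
Proof.
move=> H PE; have HD := S1_dual H; have PD : order_P' (dual_ems E) by rewrite order_P'_dual.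
have [xs ED hxs] := S1d_last HD PD.
have xsN : {in xs, forall r, 0 <= rA r <= N}.
  move=> x xin; have xD : x \in dual_ems E by rewrite ED mem_cat xin.
  have [hx _] := S1d_supp N_ge0 e_N HD xD.
  move: PD; rewrite ED /order_P' pairwise_cat /= => /and3P[/allrelP/(_ x _ xin (mem_head _ _)) /= + _ _].
  by case/and3P: (allP hxs _ xin) => /eqP-> _ _; lia.
rewrite ED in PD; have [PG step H12] := lui_S1d_last hxs xsN PD.
have HG : S2d N e (xs ++ [:: Row (N + 1) N 0 (tau N e)]) by apply/H12; rewrite -ED.
exists (dual_ems (xs ++ [:: Row (N + 1) N 0 (tau N e)])); first exact: S2d_dual.
apply: rst_step; apply: Or44; split=> //.
- by rewrite /vems (S1_valid H) order_P'_admissible.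
- by apply: S2_vems; apply: S2d_dual.
by exists (xs ++ [:: Row (N + 1) N 0 (tau N e)]); rewrite ?ED.
Qed.

(** All inner supports lie inside [N+1, -N], so the outer row moves right one exchange at a time. At
    the end of the list it can be split by an inverse ui. *)
Lemma S2_outer_last xs o ys : S2 N e (xs ++ o :: ys) -> rA o = N + 1 ->
  exists zs o', [/\ S2 N e (zs ++ [:: o']), rA o' = N + 1
    & ems_equiv (xs ++ o :: ys) (zs ++ [:: o'])].
Proof.
elim: ys xs o => [|y ys IH] xs o H oA; first by exists xs, o; split=> //; apply: rst_refl.
have mem r : r \in [:: o; y] -> r \in xs ++ o :: y :: ys.
  by rewrite mem_cat !in_cons => /or3P[->|->|//]; rewrite !orbT.
have oB : rB o = - N.
  by have := S2_supp N_ge0 e_N H (mem o (mem_head _ _)); lia.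
have yin : inner false (- -1) y /\ rA y \in e.
  have e_le A : A \in e -> A <= N by move/(allP e_N)/andP=> [].
  have [|_ /= /andP[hy _] _ hp] := form_outer_unique e_le _ H; first by lia.
  by split=> //; rewrite -(perm_mem hp) map_f // mem_cat mem_head orbT.
have yA : 0 <= rA y <= N by apply: (allP e_N); case: yin.
have sub : subsupp y o.
  by case: yin => /and3P[/eqP yB _ _] _; rewrite /subsupp yB oA oB; lia.
have ex := Exchange1 sub; set t := exch_inner o y in ex; set u := exch_outer _ o y in ex.
(* [step_R] constrains only the rows, so every label may be 0. *)
pose L := [seq (0%N, r) | r <- xs] ++ (0%N, o) :: (0%N, y) :: [seq (0%N, r) | r <- ys].
pose M := [seq (0%N, r) | r <- xs] ++ (0%N, t) :: (0%N, u) :: [seq (0%N, r) | r <- ys].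
have unz (s : seq row) : unzip2 [seq (0%N, r) | r <- s] = s.
  by rewrite /unzip2 -map_comp map_id.
have EL : rows L = xs ++ o :: y :: ys by rewrite /rows /unzip2 map_cat /= -!/unzip2 !unz.
have EM : rows M = (xs ++ [:: t]) ++ u :: ys.
  by rewrite /rows /unzip2 map_cat /= -!/unzip2 !unz -catA.
have HM : S2 N e (rows M).
  rewrite EM -catA /=; apply: form_exchange ex H => //.
    by apply: (@swaps_even _ _ _ _ _ false) => //; lia.
  by apply/allP => A /(allP e_N) /=; lia.
have LM : lexchange L M.
  split; rewrite ?EL; try exact: S2_vems.
  by exists [seq (0%N, r) | r <- xs], 0%N, o, 0%N, y, [seq (0%N, r) | r <- ys], t, u.
rewrite EM in HM; have [|zs [o' [Hz oz Ez]]] := IH _ _ HM.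
  by rewrite (exch_outer_supp _ o y).1.
exists zs, o'; split=> //; apply: rst_trans Ez; apply: rst_step; apply: Or42.
by exists L, M.
Qed.

(** Once the outer row is last, [S2_special] reads the list as a member of [S2d], and the merging of
    [N, N] and [N+1, N+1] is run backwards. *)
Lemma equiv_S1d F : special N e -> S2 N e F -> exists2 D, S1d N e D & ems_equiv F D.
Proof.
move=> sp HF; case: (HF) => [xs [o [ys [EF _ _ hO _]]]]; rewrite EF in HF *.
have oA : rA o = N + 1 by case/and4P: hO => /eqP.
have [zs [o' [Hz o'A Ez]]] := S2_outer_last HF oA.
have Hzd : S2d N e (zs ++ [:: o']) by apply/S2_special.
have e_le A : A \in e -> A <= N by move/(allP e_N)/andP=> [].
have [|hzs _ hO' hp] := form_outer_unique e_le _ Hzd; first by lia.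
have zsN : {in zs, forall r, 0 <= rA r <= N}.
  by move=> r rz; apply: (allP e_N); rewrite -(perm_mem hp) cats0 map_f.
have Eo' : o' = Row (N + 1) N 0 (tau N e).
  have sz := perm_size hp; rewrite cats0 size_map in sz.
  move: hO'; rewrite sz addbb => /and4P[/eqP h1 /eqP h2 /eqP h3 /eqP h4].
  by apply: row_eq; rewrite ?h3.
have N0 : N = 0 by case/andP: sp => /eqP.
(* With N = 0 all rows of [zs] have B = 0, so the split list is in (P') order. *)
have PD : order_P' (zs ++ [:: Row N N 0 (tau N e); Row (N + 1) (N + 1) 0 (- tau N e)]).
  have z0 r : r \in zs -> rB r = 0.
    by move=> rz; have := zsN _ rz; case/and3P: (allP hzs _ rz) => /eqP-> _ _; lia.
  rewrite /order_P' pairwise_cat; apply/and3P; split.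
  - apply/allrelP => r s /z0-> ; rewrite !inE => /orP[] /eqP-> /=; lia.
  - apply/(pairwiseP (Row 0 0 0 1)) => i j; rewrite !inE => iz jz _.
    by rewrite !z0 ?mem_nth.
  - by rewrite /= !andbT; lia.
have [_ step H12] := lui_S1d_last hzs zsN PD.
exists (zs ++ [:: Row N N 0 (tau N e); Row (N + 1) (N + 1) 0 (- tau N e)]).
  by apply/H12; rewrite -Eo'.
apply: rst_trans Ez _; apply: rst_sym; rewrite Eo'; apply: rst_step; exact: Or43.
Qed.
End Members.

(** * Counting the parameters *)

Local Open Scope classical_set_scope.
Local Open Scope card_scope.

Lemma card_seq (T : choiceType) (s : seq T) : uniq s -> [set` s] #= `I_(size s).
Proof.
move=> us; have -> : [set` s] = [set` [fset x in s]%fset].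
  by apply/seteqP; split=> x /=; rewrite inE.
by apply/card_eq_fsetP; rewrite card_fseq undup_id.
Qed.

Section PsiOfClass.
Variables (N : int) (e : seq int).
Hypotheses (N_ge0 : 0 <= N) (e_N : all (fun A => 0 <= A <= N) e).

(** In each of the three, the leading pair is (a, b) for the outer support: [N+1, -N-1], [N+1, -N]
    and [N+1, N+1] respectively. *)
Definition psi1 : {mset int * int}%mset :=
  seq_mset ((1, N + N + 3) :: map (inner_par false) (N :: e)).
Definition psi2 : {mset int * int}%mset :=
  seq_mset ((2, N + N + 2) :: map (inner_par false) e).
Definition psi3 : {mset int * int}%mset :=
  seq_mset ((N + N + 3, 1) :: map (inner_par true) (N :: e)).

Lemma psi_S1 E : S1 N e E -> psi E = psi1.
Proof.
apply: psi_form => p o /and4P[/eqP oA /eqP oB _ _].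
by rewrite /ra /rb oA oB; congr pair; lia.
Qed.

Lemma psi_S2 E : S2 N e E -> psi E = psi2.
Proof.
apply: psi_form => p o /and4P[/eqP oA /eqP oB _ _].
by rewrite /ra /rb oA oB; congr pair; lia.
Qed.

Lemma psi_S1d E : S1d N e E -> psi E = psi3.
Proof.
apply: psi_form => p o /and4P[/eqP oA /eqP oB _ _].
by rewrite /ra /rb oA oB; congr pair; lia.
Qed.

Lemma psi12 : psi1 != psi2.
Proof.
(* The merging removed one row, so [psi2] has one summand fewer. *)
apply/eqP => /eq_seq_msetP/perm_size; rewrite /= !size_map => -[]; lia.
Qed.

Lemma psi32 : psi3 != psi2.
Proof.
apply/eqP => /eq_seq_msetP/perm_size; rewrite /= !size_map => -[]; lia.
Qed.

Lemma psi13 : psi1 != psi3.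
Proof.
(* All pairs of [psi1] have a = 1, whereas 2N + 3 > 1. *)
apply/eqP => /eq_seq_msetP/perm_mem/(_ (N + N + 3, 1)).
rewrite mem_head in_cons => /orP[/eqP[]|/mapP[A _ []]]; lia.
Qed.

Lemma Psi_S1 E : S1 N e E -> order_P' E ->
  Psi E = [set` if special N e then [:: psi1; psi2; psi3] else [:: psi1; psi2]].
Proof.
move=> HE PE; have [F HF EF] := equiv_S2 N_ge0 e_N HE PE.
have := psi_S1d; have := psi_S2; have := psi_S1.
move: psi1 psi2 psi3 => p1 p2 p3 h1 h2 h3; apply/seteqP; split=> x /=.
  case=> G /(ems_equiv_invariant N_ge0 e_N)[_ /(_ (or_introl HE))].
  case=> [/h1-> ->|[/h2-> ->|[-> /h3-> ->]]].
  - by case: ifP; rewrite mem_head.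
  - by case: ifP; rewrite !inE eqxx orbT.
  - by rewrite !inE eqxx !orbT.
have P1 : Psi E p1 by exists E; [exact: rst_refl | rewrite (h1 _ HE)].
have P2 : Psi E p2 by exists F; [exact: rst_sym | rewrite (h2 _ HF)].
case: ifP => [sp|_]; rewrite !inE; last by case/orP=> /eqP->.
have [D HD FD] := equiv_S1d N_ge0 e_N sp HF.
case/or3P=> /eqP-> //; exists D; last by rewrite (h3 _ HD).
by apply: rst_sym; apply: rst_trans FD.
Qed.

Lemma card_Psi_S1 E : S1 N e E -> order_P' E ->
  Psi E #= `I_(if special N e then 3 else 2).
Proof.
move=> HE PE; rewrite Psi_S1 //; move: psi12 psi13 psi32; move: psi1 psi2 psi3.
move=> p1 p2 p3 h12 h13 h32; case: ifP => _; apply: card_seq; rewrite /= !inE.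
  by rewrite !negb_or h12 h13 eq_sym h32.
by rewrite h12.
Qed.
End PsiOfClass.

(** * Blocks starting at zero, and the conclusion *)

Lemma dual_centered E : (forall r, r \in E -> exists2 A : int, 0 <= A & r = Row A (- A) A 1) ->
  exists2 h, is_sign h & dual_ems E = [seq Row A A 0 h | A <- rev (map rA E)].
Proof.
move=> hE; exists ((-1) ^ (sum_ra E + 1)); first exact: is_sign_exp.
rewrite dual_emsE map_rev -map_comp; congr rev; apply/eq_in_map => r /hE[A _ ->].
rewrite /dual_row /ra /= subrr add0r mulr1 opprK; congr Row; lia.
Qed.

Lemma block_special x E : let N := rA x in
  (forall r, r \in x :: E -> exists2 A : int, 0 <= A & r = Row A (- A) A 1) ->
  all (fun A => 0 <= A <= N) (map rA E) ->
  block_at_zero (dual_ems (x :: E)) /\ odd (multiplicity N (dual_ems (x :: E)))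
  <-> special N (map rA E).
Proof.
move=> N hE hN; have [h hh ->] := dual_centered hE.
have N_ge0 : 0 <= N by rewrite /N; have [A hA ->] := hE x (mem_head _ _).
rewrite [map rA (x :: E)]/= -/N; set e := map rA E in hN *; clearbody N e.
have e_ge A : A \in N :: e -> 0 <= A <= N by apply: e_bound.
have mE c : multiplicity c [seq Row A A 0 h | A <- rev (N :: e)] = count_mem c (N :: e).
  by rewrite /multiplicity map_rev count_rev count_map; apply: eq_count => A /=; rewrite andbb.
have m_gt0 c : (0 < multiplicity c [seq Row A A 0 h | A <- rev (N :: e)])%N = (c \in N :: e).
  by rewrite mE -has_count has_pred1.
have all0 : N = 0 -> count_mem N (N :: e) = size (N :: e).
  move=> N0; apply/eqP; rewrite -all_count; apply/allP => A /e_ge /=; lia.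
split.
  case=> -[_ _ [cmax c0 hc] _ halt]; rewrite mE /special.
  suff N0 : N = 0 by rewrite -(all0 N0) => ->; rewrite N0.
  have Nc : 0 <= N <= cmax by rewrite -hc m_gt0 mem_head.
  have occ c : 0 <= c <= cmax -> Row c c 0 h \in [seq Row A A 0 h | A <- rev (N :: e)].
    by rewrite -hc m_gt0 => ce; apply: map_f; rewrite mem_rev.
  (* For N >= 1 the columns 0 and 1 would both occur, with the same sign [h]. *)
  have [//|N1] : N = 0 \/ 1 <= N by lia.
  have := halt _ _ (occ 0 _) (occ 1 _) erefl; rewrite /=; move: hh; rewrite /is_sign.
  by move=> hh H; have := H ltac:(lia) ltac:(lia); lia.
case/andP=> /eqP N0 on; rewrite mE all0 //; split=> //.
have e0 A : A \in rev (N :: e) -> A = 0 by rewrite mem_rev => /e_ge; lia.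
split.
- by rewrite -size_eq0 size_map size_rev.
- apply/and3P; split.
  + by apply/allP => _ /mapP[A /e0-> ->] /=; exact: hh.
  + rewrite pairwise_map; apply/(pairwiseP 0) => i j; rewrite !inE => /(mem_nth 0)/e0 hi /(mem_nth 0)/e0 hj _.
    by rewrite /= hi hj.
  + rewrite pairwise_map; apply/(pairwiseP 0) => i j _ _ _.
    by apply/implyP => _; apply: eqxx.
- exists 0 => // c; rewrite m_gt0; apply/idP/idP => [/e_ge|c0]; first by rewrite N0.
  by rewrite (_ : c = N) ?mem_head //; lia.
- by move=> c; rewrite m_gt0 mE => /e_ge cN; rewrite (_ : c = N) ?all0 //; lia.
by move=> r s /mapP[A /e0-> ->] /mapP[B /e0-> ->].
Qed.

Theorem theorem4p19 (E : seq row)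
  (E_nonempty : E != [::])
  (E_vems : vems E)
  (E_P' : order_P' E)
  (E_rows : forall r, r \in E ->
     exists2 A : int, 0 <= A & r = Row A (- A) A 1) :
  (block_at_zero (dual_ems E) /\ odd (multiplicity (first_A E) (dual_ems E)) ->
     Psi (Theta1 E) #= `I_3) /\
  (~ (block_at_zero (dual_ems E) /\ odd (multiplicity (first_A E) (dual_ems E))) ->
     Psi (Theta1 E) #= `I_2).
Proof.
case: E E_nonempty E_vems E_P' E_rows => // x E _ _ PE hE.
have N_ge0 : 0 <= rA x by have [A hA ->] := hE x (mem_head _ _).
(* In (P') order B = -A increases, so the first row has the largest A. *)
have e_N : all (fun A => 0 <= A <= rA x) (map rA E).
  rewrite all_map; apply/allP => y yE /=; move: PE => /= /andP[/allP/(_ y yE) + _].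
  have [B hB ->] := hE x (mem_head _ _).
  have [|A hA ->] := hE y; first by rewrite in_cons yE orbT.
  by rewrite /= ; lia.
(* No row precedes the new one, so its parity is even: l = N + 1 and sign -1. *)
have HS1 : S1 (rA x) (map rA E) (Theta1 (x :: E)).
  exists [::], (Row (rA x + 1) (- rA x - 1) (rA x + 1) (-1)), (x :: E); split=> //.
    by apply/allP => r /hE[A hA ->]; rewrite /inner /= !eqxx.
  by rewrite /outer_odd /=; lia.
have HP : order_P' (Theta1 (x :: E)).
  rewrite /order_P' /Theta1 /first_A; apply/andP; split; last exact: PE.
  apply/allP => r rE; have [A hA Er] := hE r rE; rewrite Er /=.
  have : A \in rA x :: map rA E.
    by rewrite -[A]/(rA (Row A (- A) A 1)) -Er (map_f rA rE).
  by move/(e_bound N_ge0 e_N); lia.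
have := card_Psi_S1 N_ge0 e_N HS1 HP; have := block_special hE e_N.
rewrite /first_A [head _ _]/=; case: (special _ _) => -[H1 H2] c; split=> // H.
  by case: H; apply: H2.
by have := H1 H.
Qed.
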